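(* Consider the robust lossy computing problem with observation costs and causal observation at decoder 2, specified by finite alphabets $\mathcal{X},\mathcal{Y},\mathcal{Z},\mathcal{A},\mathcal{T}_1,\mathcal{T}_2,\hat{\mathcal{T}}_1,\hat{\mathcal{T}}_2$, a joint pmf $p(x,y)$ on $\mathcal{X}\times\mathcal{Y}$, a conditional pmf $p(z|a,x,y)$, functions $f_j:\mathcal{X}\times\mathcal{Y}\times\mathcal{Z}\to\mathcal{T}_j$, distortion measures $d_j:\mathcal{T}_j\times\hat{\mathcal{T}}_j\to[0,\infty)$ ($j=1,2$) and a cost function $\Lambda:\mathcal{A}\to[0,\infty)$. For $D_1,D_2,\Gamma\ge 0$, let $R(D_1,D_2,\Gamma)$ be the computational rate-distortion-cost function (the infimum of achievable rates, as defined in the context, with decoder 2 producing its $i$-th reconstruction symbol from the message and $Z^i=(Z_1,\dots,Z_i)$ only). Then $$R(D_1,D_2,\Gamma)=\min\left[I(X;A)+I(X;\hat T_1|A)+I(X;U|A,\hat T_1)\right],$$ where the minimum is over all conditional pmfs $p(a,u,\hat t_1|x)$ (with $a\in\mathcal{A}$, $\hat t_1\in\hat{\mathcal{T}}_1$, and $u$ in an auxiliary alphabet $\mathcal{U}$) and all deterministic functions $\hat t_2:\mathcal{U}\times\mathcal{Z}\to\hat{\mathcal{T}}_2$ such that $$\mathrm{E}[\Lambda(A)]\le\Gamma,\qquad \mathrm{E}[d_j(T_j,\hat T_j)]\le D_j,\quad j=1,2,$$ with $T_j=f_j(X,Y,Z)$, all mutual informations and expectations being computed with respect to the joint distribution $$p(x,y,z,u,a,\hat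 t_1,\hat t_2)=p(x,y)\,p(z|a,x,y)\,p(a,u,\hat t_1|x)\,\delta(\hat t_2-\hat t_2(u,z)),$$ and where $U$ is an auxiliary random variable whose alphabet has cardinality $|\mathcal{U}|\le|\mathcal{X}||\mathcal{A}|+3$.
   Context: Mutual informations are in bits (logarithms to base 2). $\delta(\hat t_2-\hat t_2(u,z))$ equals $1$ if $\hat t_2=\hat t_2(u,z)$ and $0$ otherwise. $[1,2^{nR}]$ denotes the set of integers between $1$ and $2^{nR}$. Model. The pairs $(X_i,Y_i)$, $i=1,\dots,n$, are i.i.d. with pmf $p(x,y)$. An $(n,R,D_1,D_2,\Gamma)$ code (with causal observation at decoder 2) consists of: - an encoder $g:\mathcal{X}^n\to[1,2^{nR}]$, producing the message $M=g(X^n)$; - an action function $\ell:[1,2^{nR}]\to\mathcal{A}^n$, producing the action sequence $A^n=\ell(M)$; - a decoding function for decoder 1, $h_1:[1,2^{nR}]\to\hat{\mathcal{T}}_1^n$, producing $\hat T_1^n=h_1(M)$; - decoding functions for decoder 2, $h_{2i}:[1,2^{nR}]\times\mathcal{Z}^i\to\hat{\mathcal{T}}_2$ for $i=1,\dots,n$, producing $\hat T_{2i}=h_{2i}(M,Z^i)$, where $Z^i=(Z_1,\dots,Z_i)$. Here, given $(X^n,Y^n,A^n)=(x^n,y^n,a^n)$, the measurement sequence $Z^n$ is distributed as $p(z^n|x^n,y^n,a^n)=\prod_{i=1}^n p(z_i|a_i,x_i,y_i)$. With $T_{ji}=f_j(X_i,Y_i,Z_i)$, the code must satisfy $$\frac1n\sum_{i=1}^n\mathrm{E}[\Lambda(A_i)]\le\Gamma,\qquad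 \frac1n\sum_{i=1}^n\mathrm{E}[d_j(T_{ji},\hat T_{ji})]\le D_j,\quad j=1,2.$$ A rate $R$ is achievable for $(D_1,D_2,\Gamma)$ if for every $\epsilon>0$ and all sufficiently large $n$ there exists an $(n,R,D_1+\epsilon,D_2+\epsilon,\Gamma+\epsilon)$ code. The computational rate-distortion-cost function $R(D_1,D_2,\Gamma)$ is the infimum of all achievable rates $R$. *)

(* Defs.v *)
From HB Require Import structures.
From mathcomp Require Import all_boot all_order all_algebra.
From mathcomp Require Import boolp classical_sets reals constructive_ereal ereal.
From mathcomp Require Import exp.

Set Implicit Arguments.
Unset Strict Implicit.
Unset Printing Implicit Defensive.

Import Order.TTheory GRing.Theory Num.Theory.
Local Open Scope classical_set_scope.
Local Open Scope ring_scope.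

Record fdist (R : realType) (T : finType) := FDist {
  fdist_fun :> T -> R ;
  fdist_ge0 : forall t, 0 <= fdist_fun t ;
  fdist_sum1 : \sum_t fdist_fun t = 1 }.

(* A random variable on the finite probability space [(Omega, P)] is a
   function on [Omega]. *)
Section FiniteProbability.
Variables (R : realType) (Omega : finType) (P : fdist R Omega).

Definition expect (V : Omega -> R) : R := \sum_w P w * V w.

Definition marginal (S : finType) (V : Omega -> S) (s : S) : R :=
  \sum_(w | V w == s) P w.

Definition log2 (t : R) : R := ln t / ln 2.

(* The convention 0 log 0 = 0 is automatic: a summand with zero joint mass is
   multiplied by zero, and all other summands have nonzero denominators. *)
Definition mutual_info (S T : finType) (V : Omega -> S) (W : Omega -> T) : R :=
  \sum_s \sum_t
    let pst := marginal (fun w => (V w, W w)) (s, t) in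
    pst * log2 (pst / (marginal V s * marginal W t)).

(* I(V; W | C), written with joint masses:
   p(s,t|c) / (p(s|c) p(t|c)) = p(c) p(s,t,c) / (p(s,c) p(t,c)). *)
Definition cond_mutual_info (S T K : finType)
    (V : Omega -> S) (W : Omega -> T) (C : Omega -> K) : R :=
  \sum_s \sum_t \sum_c
    let pstc := marginal (fun w => (V w, W w, C w)) (s, t, c) in
    pstc * log2 (marginal C c * pstc /
                 (marginal (fun w => (V w, C w)) (s, c) *
                  marginal (fun w => (W w, C w)) (t, c))).

End FiniteProbability.

Record problem (R : realType) (X Y Z A T1 T2 Th1 Th2 : finType) := Problem {
  src : fdist R (X * Y)%type ;                      (* p(x,y) *)
  meas : A -> X -> Y -> fdist R Z ;                 (* p(z|a,x,y) *)
  f1 : X -> Y -> Z -> T1 ;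
  f2 : X -> Y -> Z -> T2 ;
  d1 : T1 -> Th1 -> R ;
  d2 : T2 -> Th2 -> R ;
  cost : A -> R ;                                   (* Lambda *)
  d1_ge0 : forall t th, 0 <= d1 t th ;
  d2_ge0 : forall t th, 0 <= d2 t th ;
  cost_ge0 : forall a, 0 <= cost a }.

(* [code X Z A Th1 Th2 n N]: block length n, N messages. Length-n sequences
   over S are functions of type {ffun 'I_n -> S}. Position i : 'I_n is the
   (i+1)-st one, so decoder 2 uses i.+1 measurement symbols there. *)
Record code (X Z A Th1 Th2 : finType) (n N : nat) := Code {
  enc : {ffun 'I_n -> X} -> 'I_N ;
  act : 'I_N -> {ffun 'I_n -> A} ;
  dec1 : 'I_N -> {ffun 'I_n -> Th1} ;
  dec2 : forall i : 'I_n, 'I_N -> {ffun 'I_i.+1 -> Z} -> Th2 }.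

Definition prefix (S : finType) (n : nat) (s : {ffun 'I_n -> S}) (i : 'I_n) :
    {ffun 'I_i.+1 -> S} :=
  [ffun j : 'I_i.+1 => s (widen_ord (ltn_ord i) j)].

(* The number of integers in [1, 2^(n r)]; it is 0 when r < 0 < n. *)
Definition nb_messages (R : realType) (n : nat) (r : R) : nat :=
  Num.truncn (2 `^ (n%:R * r)).

Section Operational.
Variables (R : realType) (X Y Z A T1 T2 Th1 Th2 : finType).
Variable S : problem R X Y Z A T1 T2 Th1 Th2.

Section CodePerformance.
Variables (n N : nat) (c : code X Z A Th1 Th2 n N).

Local Notation seqs :=
  ({ffun 'I_n -> X} * {ffun 'I_n -> Y} * {ffun 'I_n -> Z})%type.

Definition actions (x : {ffun 'I_n -> X}) : {ffun 'I_n -> A} :=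
  act c (enc c x).

Definition code_mass (w : seqs) : R :=
  let: (x, y, z) := w in
  (\prod_(i < n) src S (x i, y i)) *
  (\prod_(i < n) meas S (actions x i) (x i) (y i) (z i)).

Lemma code_mass_ge0 w : 0 <= code_mass w.
Proof.
by case: w => -[x y] z; rewrite mulr_ge0 ?prodr_ge0// => i _; exact: fdist_ge0.
Qed.

Lemma code_mass_sum1 : \sum_w code_mass w = 1.
Proof.
pose F (x : {ffun 'I_n -> X}) (y : {ffun 'I_n -> Y}) (z : {ffun 'I_n -> Z}) :=
  code_mass (x, y, z).
transitivity (\sum_x \sum_y \sum_z F x y z).
  rewrite pair_bigA pair_bigA /=; apply: eq_bigr => -[[x y] z] _ //.
transitivity (\sum_(x : {ffun 'I_n -> X}) \sum_(y : {ffun 'I_n -> Y})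
    \prod_(i < n) src S (x i, y i)).
  apply: eq_bigr => x _; apply: eq_bigr => y _; rewrite /F /= -big_distrr /=.
  rewrite -(bigA_distr_bigA (fun i z => meas S (actions x i) (x i) (y i) z)).
  by rewrite [X in _ * X]big1 ?mulr1// => i _; exact: fdist_sum1.
under eq_bigr => x _ do
  rewrite -(bigA_distr_bigA (fun i y => src S (x i, y))).
rewrite -(bigA_distr_bigA (fun i x => \sum_y src S (x, y))) big1// => i _.
rewrite pair_bigA /= -(fdist_sum1 (src S)).
by apply: eq_bigr => -[].
Qed.

(* The joint law of (X^n, Y^n, Z^n) induced by the code. *)
Definition code_dist : fdist R seqs := FDist code_mass_ge0 code_mass_sum1.

Definition avg_cost : R :=
  n%:R^-1 * \sum_(i < n)
    expect code_dist (fun '(x, y, z) => cost S (actions x i)).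

Definition avg_distortion1 : R :=
  n%:R^-1 * \sum_(i < n)
    expect code_dist (fun '(x, y, z) =>
      d1 S (f1 S (x i) (y i) (z i)) (dec1 c (enc c x) i)).

Definition avg_distortion2 : R :=
  n%:R^-1 * \sum_(i < n)
    expect code_dist (fun '(x, y, z) =>
      d2 S (f2 S (x i) (y i) (z i)) (dec2 c (enc c x) (prefix z i))).

End CodePerformance.

Definition has_code (n : nat) (r D1 D2 G : R) : Prop :=
  exists c : code X Z A Th1 Th2 n (nb_messages n r),
    [/\ avg_cost c <= G, avg_distortion1 c <= D1 & avg_distortion2 c <= D2].

Definition achievable (D1 D2 G r : R) : Prop :=
  forall eps : R, 0 < eps ->
    exists n0 : nat, forall n : nat, (n0 <= n)%N ->
      has_code n r (D1 + eps) (D2 + eps) (G + eps).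

(* Extended-real valued: +oo when no rate is achievable. *)
Definition rate_function (D1 D2 G : R) : \bar R :=
  ereal_inf [set r%:E | r in achievable D1 D2 G].

End Operational.

Section SingleLetter.
Variables (R : realType) (X Y Z A T1 T2 Th1 Th2 : finType).
Variable S : problem R X Y Z A T1 T2 Th1 Th2.
Variables (U : finType) (q : X -> fdist R (A * U * Th1)%type).
Variable (that2 : U -> Z -> Th2).

Local Notation space := (X * Y * Z * U * A * Th1 * Th2)%type.

Definition joint_mass (w : space) : R :=
  let: (x, y, z, u, a, t1, t2) := w in
  src S (x, y) * meas S a x y z * q x (a, u, t1) * (t2 == that2 u z)%:R.

Lemma joint_mass_ge0 w : 0 <= joint_mass w.
Proof.
by case: w => -[[[[[x y] z] u] a] t1] t2; rewrite !mulr_ge0 ?fdist_ge0 ?ler0n.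
Qed.

Lemma joint_mass_sum1 : \sum_w joint_mass w = 1.
Proof.
pose F x y z u a t1 t2 := joint_mass (x, y, z, u, a, t1, t2).
transitivity (\sum_x \sum_y \sum_z \sum_u \sum_a \sum_t1 \sum_t2
    F x y z u a t1 t2).
  by rewrite !pair_bigA /=; apply: eq_bigr => -[[[[[[x y] z] u] a] t1] t2] _.
transitivity (\sum_x \sum_y src S (x, y)); last first.
  by rewrite pair_bigA /= -(fdist_sum1 (src S)); apply: eq_bigr => -[].
apply: eq_bigr => x _; apply: eq_bigr => y _.
transitivity (\sum_z \sum_u \sum_a \sum_t1
    src S (x, y) * meas S a x y z * q x (a, u, t1)).
  apply: eq_bigr => z _; apply: eq_bigr => u _.
  apply: eq_bigr => a _; apply: eq_bigr => t1 _.
  rewrite /F /= -big_distrr /= (bigD1 (that2 u z)) //= eqxx big1 ?addr0 ?mulr1// => t.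
  by move/negbTE ->.
rewrite exchange_big /=; under eq_bigr => u _ do rewrite exchange_big /=.
under eq_bigr => u _.
  under eq_bigr => a _.
    rewrite exchange_big /=.
    under eq_bigr => t1 _ do
      rewrite -big_distrl -big_distrr /= fdist_sum1 mulr1.
    over.
  over.
rewrite exchange_big pair_bigA pair_bigA /= -big_distrr /=.
rewrite -[RHS]mulr1 -(fdist_sum1 (q x)); congr (_ * _).
by apply: eq_bigr => -[[]].
Qed.

Definition joint : fdist R space := FDist joint_mass_ge0 joint_mass_sum1.

Definition rvX (w : space) : X := let: (x, y, z, u, a, t1, t2) := w in x.
Definition rvU (w : space) : U := let: (x, y, z, u, a, t1, t2) := w in u.
Definition rvA (w : space) : A := let: (x, y, z, u, a, t1, t2) := w in a.
Definition rvTh1 (w : space) : Th1 := let: (x, y, z, u, a, t1, t2) := w in t1.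
Definition rvTh2 (w : space) : Th2 := let: (x, y, z, u, a, t1, t2) := w in t2.
Definition rvT1 (w : space) : T1 :=
  let: (x, y, z, u, a, t1, t2) := w in f1 S x y z.
Definition rvT2 (w : space) : T2 :=
  let: (x, y, z, u, a, t1, t2) := w in f2 S x y z.

Definition feasible (D1 D2 G : R) : Prop :=
  [/\ expect joint (fun w => cost S (rvA w)) <= G,
      expect joint (fun w => d1 S (rvT1 w) (rvTh1 w)) <= D1 &
      expect joint (fun w => d2 S (rvT2 w) (rvTh2 w)) <= D2].

Definition info_rate : R :=
  mutual_info joint rvX rvA
  + cond_mutual_info joint rvX rvTh1 rvA
  + cond_mutual_info joint rvX rvU (fun w => (rvA w, rvTh1 w)).

End SingleLetter.

Definition single_letter_rates (R : realType)
    (X Y Z A T1 T2 Th1 Th2 : finType)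
    (S : problem R X Y Z A T1 T2 Th1 Th2) (D1 D2 G : R) : set (\bar R) :=
  [set r | exists (U : finType) (q : X -> fdist R (A * U * Th1)%type)
             (that2 : U -> Z -> Th2),
      [/\ (#|U| <= #|X| * #|A| + 3)%N,
          feasible S q that2 D1 D2 G &
          r = (info_rate S q that2)%:E] ].

(* [m] is the minimum of [V]; the minimum of the empty set is +oo, which is the
   value of [ereal_inf set0]. *)
Definition is_min (R : realType) (V : set (\bar R)) (m : \bar R) : Prop :=
  m = ereal_inf V /\ (V !=set0 -> V m).

(* Main.v *)
(* Both decoders together use at each position one letter of the finite alphabet
   of triples (action, reconstruction of decoder 1, map from the current
   measurement to the reconstruction of decoder 2).  With these "strategies" as
   reproduction letters, the problem is a rate-distortion problem for the source
   X with three additive losses, and the three mutual informations add up to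
   I(X; A, U, T1).

   Converse.  Let P be the average over the positions i of the laws of (X_i, W_i),
   W_i being the strategy in use, a function of the message and of Z^{i-1}.  For
   every backward channel r(x|w), the inequality ln t <= t - 1 bounds
   n E_P[ln (r(X|W) / p(X))] by ln E[prod_i r(X_i|W_i) / p(X_i)] up to
   normalization, and summing over all N messages instead of the actual one shows
   that this mean is at most N, each message contributing the total mass of a
   causal kernel.  These bounds and the loss constraints are linear in P, so they
   survive a limit of P along codes with vanishing slack; the best r then gives
   I(X; W) <= R at the limit.  A basic solution of the linear program of reweighting
   the strategies uses at most |X| + 3 of them.

   Achievability is random coding with a Chernoff bound for typicality. *)

From mathcomp Require Import all_boot all_order all_algebra.
From mathcomp Require Import boolp classical_sets reals constructive_ereal ereal.
From mathcomp Require Import topology normedtype sequences exp.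
From mathcomp Require Import ring lra.
Require Import Defs.

Set Implicit Arguments.
Unset Strict Implicit.
Unset Printing Implicit Defensive.

Import Order.TTheory GRing.Theory Num.Theory numFieldNormedType.Exports.
Local Open Scope ring_scope.

(** * Sums over sequences *)

Section FiniteSums.
Variable R : realType.

Lemma sum_prod_ffun (n : nat) (T : finType) (F : 'I_n -> T -> R) :
  \sum_(s : {ffun 'I_n -> T}) \prod_i F i (s i) = \prod_i \sum_t F i t.
Proof. by rewrite bigA_distr_bigA. Qed.

Lemma sum_ffun_pair (n : nat) (T V : finType)
    (F : {ffun 'I_n -> T} -> {ffun 'I_n -> V} -> R) :
  \sum_a \sum_b F a b =
  \sum_(s : {ffun 'I_n -> T * V}) F [ffun i => (s i).1] [ffun i => (s i).2].
Proof.
rewrite pair_bigA /=.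
rewrite (reindex (fun s : {ffun 'I_n -> T * V} =>
  ([ffun i => (s i).1], [ffun i => (s i).2]))) //=.
exists (fun p : {ffun 'I_n -> T} * {ffun 'I_n -> V} =>
  [ffun i => (p.1 i, p.2 i)]) => [s _|[a b] _] /=.
  by apply/ffunP => i; rewrite !ffunE -surjective_pairing.
by congr (_, _); apply/ffunP => i; rewrite !ffunE.
Qed.

Definition upd (n : nat) (T : finType) (s : {ffun 'I_n -> T}) (i : 'I_n) (v : T) :
    {ffun 'I_n -> T} := [ffun j => if j == i then v else s j].

Section Update.
Variables (n : nat) (T : finType).
Implicit Types (s : {ffun 'I_n -> T}) (i j : 'I_n).

Lemma upd_same s i v : upd s i v i = v.
Proof. by rewrite ffunE eqxx. Qed.

Lemma upd_other s i j v : j != i -> upd s i v j = s j.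
Proof. by rewrite ffunE => /negbTE ->. Qed.

Lemma upd_id s i : upd s i (s i) = s.
Proof. by apply/ffunP => j; rewrite ffunE; case: eqP => // ->. Qed.

Lemma upd_upd s i v w : upd (upd s i v) i w = upd s i w.
Proof. by apply/ffunP => j; rewrite !ffunE; case: eqP. Qed.

(* [(s, v) |-> (upd s i v, s i)] is an involution. *)
Lemma sum_upd i (F : {ffun 'I_n -> T} -> R) :
  \sum_s \sum_v F (upd s i v) = \sum_s F s *+ #|T|.
Proof.
rewrite pair_bigA /=.
rewrite (reindex_inj (h := fun p : {ffun 'I_n -> T} * T =>
  (upd p.1 i p.2, p.1 i))) /=; last first.
  apply: (can_inj (g := fun p => (upd p.1 i p.2, p.1 i))) => -[s v] /=.
  by rewrite upd_same upd_upd upd_id.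
under eq_bigr do rewrite upd_upd upd_id.
rewrite -(pair_bigA _ (fun s (v : T) => F s)) /=.
by apply: eq_bigr => s _; rewrite sumr_const.
Qed.

(** By [sum_upd], multiplying by [#|T|] turns each side into a sum of sums over the [i]-th
    coordinate; for empty [T] there is no sequence, since [i] exists. *)
Lemma ler_sum_coord i (F H : {ffun 'I_n -> T} -> R) :
  (forall s, \sum_v F (upd s i v) <= \sum_v H (upd s i v)) ->
  \sum_s F s <= \sum_s H s.
Proof.
move=> le_FH.
have [T0|T0] := posnP #|T|.
  rewrite !big1// => s _; by have := fintype0 (s i).
by rewrite -(ler_pMn2r T0) -!sumrMnl -!(sum_upd i) ler_sum.
Qed.

Lemma eq_sum_coord i (F H : {ffun 'I_n -> T} -> R) :
  (forall s, \sum_v F (upd s i v) = \sum_v H (upd s i v)) ->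
  \sum_s F s = \sum_s H s.
Proof.
move=> eqFH; apply/eqP; rewrite eq_le.
by apply/andP; split; apply: (@ler_sum_coord i) => s; rewrite eqFH.
Qed.

(* Replacing the factors by the uniform one, the last factor first, only
   increases the sum. *)
Lemma sum_causal_kernel_le1 (K : 'I_n -> {ffun 'I_n -> T} -> R) :
  (forall i s, 0 <= K i s) ->
  (forall i j s v, (i < j)%N -> K i (upd s j v) = K i s) ->
  (forall i s, \sum_v K i (upd s i v) <= 1) ->
  \sum_s \prod_i K i s <= 1.
Proof.
move=> K0 Kcausal K1.
have [T0|T0] := posnP #|T|.
  have [n0|n0] := posnP n.
    have I0 (i : 'I_n) : False by case: i => m; rewrite n0.
    rewrite (eq_bigr (fun=> 1)); last by move=> s _; rewrite big1// => i; case: (I0 i).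
    by rewrite sumr_const card_ffun card_ord n0 expn0.
  by rewrite big1// => s _; have := fintype0 (s (Ordinal n0)).
(* Hybrids: the first [k] factors are kernels and the others uniform, so [W 0] is 1 and [W n] is the
   sum to be bounded. *)
pose W k := \sum_(s : {ffun 'I_n -> T})
  \prod_(i < n) (if (i < k)%N then K i s else #|T|%:R^-1).
have W0 : W 0%N = 1.
  rewrite /W (sum_prod_ffun (fun _ _ => #|T|%:R^-1)) big1// => i _.
  by rewrite sumr_const -[X in X *+ _]mul1r -mulrnAr -mulr_natr mul1r mulVf// pnatr_eq0 -lt0n.
have Wn : W n = \sum_s \prod_i K i s.
  by apply: eq_bigr => s _; apply: eq_bigr => i _; rewrite ltn_ord.
have Wle k : (k <= n)%N -> W k <= 1.
  elim: k => [|k IH] kn; first by rewrite W0.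
  apply: le_trans (IH (ltnW kn)); pose i := Ordinal kn.
  apply: (@ler_sum_coord i) => s.
  pose C := \prod_(j < n | j != i) (if (j < k)%N then K j s else #|T|%:R^-1).
  have C0 : 0 <= C by apply: prodr_ge0 => j _; case: ifP => // _; rewrite invr_ge0.
  have e1 v : \prod_(j < n) (if (j < k.+1)%N then K j (upd s i v) else #|T|%:R^-1) =
      K i (upd s i v) * C.
    rewrite (bigD1 i) //= ltnSn; congr (_ * _); apply: eq_bigr => j ji.
    have -> : (j < k.+1)%N = (j < k)%N.
      by rewrite ltnS leq_eqVlt; case: eqP => // e; case/eqP: ji; apply: val_inj.
    by case: ifP => // jk; rewrite Kcausal.
  have e2 v : \prod_(j < n) (if (j < k)%N then K j (upd s i v) else #|T|%:R^-1) =
      #|T|%:R^-1 * C.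
    rewrite (bigD1 i) //= ltnn; congr (_ * _); apply: eq_bigr => j ji.
    by case: ifP => // jk; rewrite Kcausal.
  under eq_bigr do rewrite e1.
  under [X in _ <= X]eq_bigr do rewrite e2.
  rewrite -big_distrl sumr_const /= -mulrnAl -[_ *+ #|T|]mulr_natr mulVf ?pnatr_eq0 -?lt0n//.
  by rewrite ler_wpM2r.
by rewrite -Wn Wle.
Qed.

End Update.

Lemma upd_snd (n : nat) (U V : finType) (s : {ffun 'I_n -> U * V}) (i : 'I_n) v :
  [ffun k => (upd s i v k).2] = upd [ffun k => (s k).2] i v.2.
Proof. by apply/ffunP => k; rewrite !ffunE; case: eqP. Qed.

Lemma sum_prod_coord (n : nat) (T : finType) (P f : T -> R) (i : 'I_n) :
  \sum_t P t = 1 ->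
  \sum_(s : {ffun 'I_n -> T}) (\prod_j P (s j)) * f (s i) = \sum_t P t * f t.
Proof.
move=> P1.
transitivity (\sum_(s : {ffun 'I_n -> T})
    \prod_j (P (s j) * (if j == i then f (s j) else 1))).
  apply: eq_bigr => s _; rewrite big_split /=; congr (_ * _).
  by rewrite -big_mkcond /= big_pred1_eq.
rewrite (sum_prod_ffun (fun j t => P t * (if j == i then f t else 1))).
rewrite (bigD1 i) //= eqxx [X in _ * X]big1 ?mulr1// => j /negbTE ->.
by under eq_bigr do rewrite mulr1.
Qed.

Lemma sum_prod_eq1 (n : nat) (T : finType) (P : T -> R) :
  \sum_t P t = 1 -> \sum_(s : {ffun 'I_n -> T}) \prod_j P (s j) = 1.
Proof.
by move=> P1; rewrite (sum_prod_ffun (fun=> P)) big1.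
Qed.

End FiniteSums.

(** * Codes and causal strategies *)

Lemma ln_prod (R : realType) (I : finType) (F : I -> R) :
  (forall i, 0 < F i) -> ln (\prod_i F i) = \sum_i ln (F i).
Proof.
move=> F0; suff [] : 0 < \prod_i F i /\ ln (\prod_i F i) = \sum_i ln (F i) by [].
elim/big_ind2: _ => [|a b c d [b0 <-] [d0 <-]|i _]; rewrite ?ln1 ?F0//.
by rewrite lnM ?posrE// mulr_gt0.
Qed.

Lemma ln_le_sub1 (R : realType) (t : R) : 0 < t -> ln t <= t - 1.
Proof. by move=> t0; have := @le_ln1Dx R (t - 1); rewrite subrKC; apply; lra. Qed.

Section CausalStrategy.
Variables (R : realType) (X Y Z A T1 T2 Th1 Th2 : finType).
Variable S : problem R X Y Z A T1 T2 Th1 Th2.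

Definition pX (x : X) : R := \sum_y src S (x, y).

Lemma pX_ge0 x : 0 <= pX x.
Proof. by apply: sumr_ge0 => y _; exact: fdist_ge0. Qed.

Lemma pX_sum1 : \sum_x pX x = 1.
Proof. by rewrite /pX pair_bigA /= -(fdist_sum1 (src S)); apply: eq_bigr => -[]. Qed.

Lemma src_eq0 x y : pX x = 0 -> src S (x, y) = 0.
Proof.
move=> /eqP; rewrite psumr_eq0; last by move=> *; exact: fdist_ge0.
by move=> /allP /(_ y) /= /(_ (mem_index_enum _)) /eqP.
Qed.

(** A pmf forces [X] to be nonempty. Encoding such a sequence shows that a code has at least one
    message. *)
Lemma src_ffun_exists n : exists x : {ffun 'I_n -> X}, true.
Proof.
have [x _|no] := pickP (fun _ : X => true); first by exists [ffun=> x].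
have /eqP := pX_sum1; rewrite big1 ?(eq_sym 0) ?oner_eq0// => x.
by have := no x.
Qed.

Variables (W : finType) (aW : W -> A).

(* The conditional expectation of [phi] given [X = x] and [W = w]; it is 0 when
   [x] has probability 0. *)
Definition cond_loss (phi : W -> X -> Y -> Z -> R) (x : X) (w : W) : R :=
  (pX x)^-1 * \sum_y \sum_z src S (x, y) * meas S (aW w) x y z * phi w x y z.

Lemma cond_loss_ge0 phi x w :
  (forall w x y z, 0 <= phi w x y z) -> 0 <= cond_loss phi x w.
Proof.
move=> phi0; rewrite mulr_ge0 ?invr_ge0 ?pX_ge0//.
by apply: sumr_ge0 => y _; apply: sumr_ge0 => z _; rewrite !mulr_ge0 ?fdist_ge0.
Qed.

Lemma pX_cond_loss phi x w : pX x * cond_loss phi x w =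
  \sum_y \sum_z src S (x, y) * meas S (aW w) x y z * phi w x y z.
Proof.
have [p0|p0] := eqVneq (pX x) 0; last by rewrite mulVKf.
rewrite p0 mul0r big1// => y _; rewrite big1// => z _.
by rewrite src_eq0// !mul0r.
Qed.

Lemma sum_src_meas x a :
  \sum_(v : Y * Z) src S (x, v.1) * meas S a x v.1 v.2 = pX x.
Proof.
rewrite -(pair_bigA _ (fun y z => src S (x, y) * meas S a x y z)) /=.
by apply: eq_bigr => y _; rewrite -big_distrr /= fdist_sum1 mulr1.
Qed.

Variables (n N : nat) (c : code X Z A Th1 Th2 n N).

(** Given [x] the actions are fixed, so the pairs [(y i, z i)] are independent and their masses form
    a single product. *)
Lemma code_expectE (V : _ -> R) : expect (code_dist S c) V =
  \sum_(x : {ffun 'I_n -> X}) \sum_(s : {ffun 'I_n -> Y * Z})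
    (\prod_i (src S (x i, (s i).1) *
       meas S (act c (enc c x) i) (x i) (s i).1 (s i).2)) *
    V (x, [ffun i => (s i).1], [ffun i => (s i).2]).
Proof.
transitivity (\sum_(x : {ffun 'I_n -> X}) \sum_(y : {ffun 'I_n -> Y})
    \sum_(z : {ffun 'I_n -> Z}) code_mass S c (x, y, z) * V (x, y, z)).
  by rewrite !pair_bigA /=; apply: eq_bigr => -[[x y] z] _.
apply: eq_bigr => x _.
rewrite (sum_ffun_pair (fun y z => code_mass S c (x, y, z) * V (x, y, z))).
apply: eq_bigr => s _; congr (_ * _) => /=.
by rewrite big_split /=; congr (_ * _); apply: eq_bigr => i _; rewrite !ffunE.
Qed.

Lemma code_expect_src (f : {ffun 'I_n -> X} -> R) :
  expect (code_dist S c) (fun '(x, y, z) => f x) =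
  \sum_(x : {ffun 'I_n -> X}) (\prod_i pX (x i)) * f x.
Proof.
rewrite code_expectE; apply: eq_bigr => x _; rewrite -big_distrl /=; congr (_ * _).
rewrite (sum_prod_ffun (fun i (v : Y * Z) => src S (x i, v.1) *
  meas S (act c (enc c x) i) (x i) v.1 v.2)).
by apply: eq_bigr => i _; rewrite sum_src_meas.
Qed.

Variable wi : 'I_n -> 'I_N -> {ffun 'I_n -> Z} -> W.
Hypothesis wi_act : forall i m z, aW (wi i m z) = act c m i.
(** The case [i = j] is included: a strategy is chosen before the current measurement is seen. *)
Hypothesis wi_causal : forall (i j : 'I_n) m z v, (i <= j)%N ->
  wi i m (upd z j v) = wi i m z.

(** The strategy at [i] ignores coordinate [i] of the measurements, so summing over that coordinate
    alone replaces the loss by its conditional mean. *)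
Lemma code_expect_loss phi i :
  expect (code_dist S c) (fun '(x, y, z) => phi (wi i (enc c x) z) (x i) (y i) (z i)) =
  expect (code_dist S c) (fun '(x, y, z) => cond_loss phi (x i) (wi i (enc c x) z)).
Proof.
rewrite !code_expectE; apply: eq_bigr => x _; apply: (@eq_sum_coord _ _ _ i) => s.
set m := enc c x.
pose kap j (v : Y * Z) := src S (x j, v.1) * meas S (act c m j) (x j) v.1 v.2.
pose C := \prod_(j < n | j != i) kap j (s j).
have split_prod v : \prod_j kap j (upd s i v j) = C * kap i v.
  rewrite (bigD1 i) //= upd_same mulrC; congr (_ * _).
  by apply: eq_bigr => j ji; rewrite upd_other.
pose w := wi i m [ffun k => (s k).2].
transitivity (\sum_v C * kap i v * phi w (x i) v.1 v.2).
  apply: eq_bigr => v _; rewrite -split_prod; congr (_ * _).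
  by rewrite !ffunE eqxx upd_snd wi_causal.
transitivity (\sum_v C * kap i v * cond_loss phi (x i) w); last first.
  apply: eq_bigr => v _; rewrite -split_prod; congr (_ * _).
  by rewrite upd_snd wi_causal.
rewrite -big_distrl -big_distrr /= sum_src_meas -mulrA pX_cond_loss.
rewrite pair_bigA big_distrr /=; apply: eq_bigr => v _.
by rewrite /kap wi_act !mulrA.
Qed.

(** The law of [(X_Q, W_Q)] for a position [Q] drawn uniformly and independently of the code. *)
Definition occupation (x : X) (w : W) : R :=
  n%:R^-1 * \sum_(i < n) expect (code_dist S c)
    (fun '(x', y, z) => ((x' i == x) && (wi i (enc c x') z == w))%:R).

Lemma occupation_ge0 x w : 0 <= occupation x w.
Proof.
rewrite mulr_ge0 ?invr_ge0//; apply: sumr_ge0 => i _; apply: sumr_ge0 => -[[x' y] z] _.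
by rewrite mulr_ge0// code_mass_ge0.
Qed.

Lemma occupation_expect (psi : X -> W -> R) :
  \sum_x \sum_w occupation x w * psi x w =
  n%:R^-1 * \sum_(i < n) expect (code_dist S c)
    (fun '(x, y, z) => psi (x i) (wi i (enc c x) z)).
Proof.
rewrite pair_bigA /=.
under eq_bigr do rewrite /occupation -mulrA big_distrl /=.
rewrite -big_distrr exchange_big /=; congr (_ * _); apply: eq_bigr => i _.
under eq_bigr do rewrite big_distrl /=.
rewrite exchange_big /=; apply: eq_bigr => -[[x y] z] _.
rewrite (bigD1 (x i, wi i (enc c x) z)) //= !eqxx /= mulr1 [X in _ + X = _]big1 ?addr0//.
move=> [x' w'] /=; rewrite xpair_eqE eq_sym [w' == _]eq_sym => /negbTE ->.
by rewrite mulr0 mul0r.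
Qed.

Lemma occupation_fst x : (0 < n)%N -> \sum_w occupation x w = pX x.
Proof.
move=> n0.
transitivity (\sum_x' \sum_w occupation x' w * (x' == x)%:R).
  rewrite (bigD1 x) //= eqxx [X in _ + X]big1 ?addr0.
    by apply: eq_bigr => w _; rewrite mulr1.
  by move=> x' /negbTE ->; rewrite big1// => w _; rewrite mulr0.
rewrite (occupation_expect (fun x' w => (x' == x)%:R)).
have -> : \sum_(i < n) expect (code_dist S c) (fun '(x', y, z) => (x' i == x)%:R)
    = \sum_(i < n) pX x.
  apply: eq_bigr => i _; rewrite (code_expect_src (fun x' => (x' i == x)%:R)).
  rewrite (sum_prod_coord (fun t => (t == x)%:R)) ?pX_sum1//.
  rewrite (bigD1 x) //= eqxx mulr1 big1 ?addr0// => t /negbTE ->.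
  by rewrite mulr0.
by rewrite sumr_const card_ord -[pX x *+ n]mulr_natl mulKf// pnatr_eq0 -lt0n.
Qed.

(* By [ln t <= t - 1] it suffices that the likelihood ratio
   [prod_i rr (X_i | W_i) / pX X_i] has mean at most [N], and this mean is at
   most a sum over the [N] messages of total masses of causal kernels. *)
Lemma occupation_info_le (rr : X -> W -> R) :
  (0 < n)%N -> (forall x w, 0 < rr x w) -> (forall w, \sum_x rr x w <= 1) ->
  \sum_x \sum_w occupation x w * ln (rr x w / pX x) <= n%:R^-1 * ln N%:R.
Proof.
move=> n0 rr0 rr1; rewrite (occupation_expect (fun x w => ln (rr x w / pX x))).
rewrite ler_wpM2l ?invr_ge0//.
pose V (t : {ffun 'I_n -> X} * {ffun 'I_n -> Y} * {ffun 'I_n -> Z}) :=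
  \prod_(i < n) (rr (t.1.1 i) (wi i (enc c t.1.1) t.2) / pX (t.1.1 i)).
have [x0 _] := src_ffun_exists n.
have N0 : 0 < N%:R :> R by rewrite ltr0n; case: (N) (enc c x0) => [[]|].
have EV : \sum_t code_mass S c t * V t <= N%:R.
  have := code_expectE V; rewrite /expect /= => ->.
  (* With the message [m] frozen, [pX] cancels and [rr] takes its place as the law of the source
     letter: [K m] is a causal subprobability kernel. *)
  pose K m i (t : {ffun 'I_n -> X * (Y * Z)}) : R :=
    src S ((t i).1, (t i).2.1) * meas S (act c m i) (t i).1 (t i).2.1 (t i).2.2 *
    (rr (t i).1 (wi i m [ffun j => (t j).2.2]) / pX (t i).1).
  have K0 m i t : 0 <= K m i t.
    by rewrite !mulr_ge0 ?fdist_ge0 ?invr_ge0 ?pX_ge0//; apply/ltW/rr0.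
  have -> : N%:R = \sum_(m < N) (1 : R) by rewrite sumr_const card_ord.
  apply: (@le_trans _ _ (\sum_(m < N) \sum_t \prod_i K m i t)); last first.
    apply: ler_sum => m _; apply: sum_causal_kernel_le1 => [i t|i j t v ij|i t]; first exact: K0.
      have ij' : i != j by rewrite -val_eqE /= ltn_eqF.
      rewrite /K upd_other//; congr (_ * (rr _ _ / _)).
      rewrite -(wi_causal m [ffun k => (t k).2.2] v.2.2 (ltnW ij)); congr wi.
      by apply/ffunP => k; rewrite !ffunE; case: eqP.
    pose w := wi i m [ffun k => (t k).2.2].
    have Kv v : K m i (upd t i v) = (rr v.1 w / pX v.1) *
        (src S (v.1, v.2.1) * meas S (act c m i) v.1 v.2.1 v.2.2).
      rewrite /K upd_same mulrC; congr (rr _ _ / _ * _).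
      rewrite /w -(wi_causal m [ffun k => (t k).2.2] v.2.2 (leqnn i)); congr wi.
      by apply/ffunP => k; rewrite !ffunE; case: eqP.
    under eq_bigr do rewrite Kv.
    rewrite -(pair_bigA _ (fun x (v : Y * Z) => (rr x w / pX x) *
      (src S (x, v.1) * meas S (act c m i) x v.1 v.2))) /=.
    apply: le_trans (rr1 w); apply: ler_sum => x _.
    rewrite -big_distrr /= sum_src_meas.
    have [->|p0] := eqVneq (pX x) 0; first by rewrite mulr0 ltW.
    by rewrite divfK.
  have -> : \sum_(m < N) \sum_t \prod_i K m i t =
      \sum_(m < N) \sum_(x : {ffun 'I_n -> X}) \sum_(s : {ffun 'I_n -> Y * Z})
        \prod_i K m i [ffun j => (x j, s j)].
    apply: eq_bigr => m _.
    rewrite (sum_ffun_pair (fun x s => \prod_i K m i [ffun j => (x j, s j)])).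
    apply: eq_bigr => t _; apply: eq_bigr => i _; congr K.
    by apply/ffunP => j; rewrite !ffunE -surjective_pairing.
  rewrite [leRHS]exchange_big /=; apply: ler_sum => x _.
  rewrite [leRHS]exchange_big /=; apply: ler_sum => s _.
  (* Only the term of the actual message is kept; the others are nonnegative. *)
  rewrite (bigD1 (enc c x)) //= -big_split /= -[leLHS]addr0.
  apply: lerD; last by apply: sumr_ge0 => m _; apply: prodr_ge0.
  rewrite le_eqVlt; apply/orP; left; apply/eqP; apply: eq_bigr => i _.
  rewrite /K !ffunE /=; congr (_ * (rr _ _ / _)); congr wi.
  by apply/ffunP => k; rewrite !ffunE.
have Emass := code_mass_sum1 S c.
(* This is [ln t <= t - 1] at [t = V / N], averaged under the code law. *)
apply: (@le_trans _ _ (\sum_t (code_mass S c t * ln N%:R +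
    code_mass S c t * V t / N%:R - code_mass S c t))); last first.
  rewrite !big_split /= sumrN -!big_distrl /= Emass mul1r.
  by rewrite -addrA gerDl subr_le0 ler_pdivrMr ?mul1r//.
rewrite /expect exchange_big /=; apply: ler_sum => -[[x y] z] _.
rewrite -mulr_sumr.
set M := code_mass S c (x, y, z).
have [->|M0] := eqVneq M 0; first by rewrite !mul0r subr0 addr0.
have p0 i : 0 < pX (x i).
  rewrite lt0r pX_ge0 andbT; apply: contra M0 => /eqP p0.
  by rewrite /M /= (bigD1 i) //= src_eq0// !mul0r.
have V0 : 0 < V (x, y, z) by apply: prodr_gt0 => i _; rewrite divr_gt0.
rewrite -mulrA -[X in _ - X]mulr1 -mulrDr -mulrBr ler_wpM2l ?code_mass_ge0//=.
rewrite -ln_prod => [|i]; last by rewrite divr_gt0.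
rewrite -/(V (x, y, z)) -addrA -lerBlDl -ln_div//.
by rewrite ln_le_sub1// divr_gt0.
Qed.

End CausalStrategy.

(** * Passing to the limit in linear inequalities *)

Section Compactness.
Variable R : realType.

(** [P] is a cluster point of the sequence in a compact cube. A single [P] serves all pairs
    [(a, b)], and no subsequence has to be extracted. *)
Lemma limit_linear_ineq (I : finType) (P_ : nat -> I -> R) :
  (forall k i, 0 <= P_ k i <= 1) ->
  exists P : I -> R, forall (a : I -> R) (b : R),
    (forall eps, 0 < eps ->
      exists k0, forall k, (k0 <= k)%N -> \sum_i a i * P_ k i <= b + eps) ->
    \sum_i a i * P i <= b.
Proof.
move=> P01; pose v_ k : 'rV[R]_#|I| := \row_j P_ k (enum_val j).
have /= := @rV_compact R #|I| (fun=> `[0, 1]%classic)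
  (fun=> @segment_compact R 0 1) (v_ @ \oo)%classic _.
case.
  exists 0%N => // k _ /= j; rewrite mxE in_itv /=; exact: P01.
move=> v [_ clv]; exists (fun i => v ord0 (enum_rank i)) => a b ab.
rewrite leNgt; apply/negP => bL.
set L := \sum_i _ in bL; pose eps := (L - b) / 2.
have eps0 : 0 < eps by rewrite divr_gt0// subr_gt0.
have [k0 k0P] := ab _ eps0.
(* Moving each coordinate by less than [eps / C] changes the linear form by less than [eps]; the 1
   keeps [C] positive. *)
pose C := 1 + \sum_i `|a i|.
have C0 : 0 < C by rewrite ltr_pwDl// sumr_ge0.
have [||u [/= [k k0k <-] vu]] := clv (v_ @` [set k | (k0 <= k)%N])%classic
    (ball v (eps / C)).
- by exists k0 => // k /= kk; exists k.
- by apply: nbhsx_ballx; rewrite divr_gt0.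
have := k0P k k0k; apply/negP; rewrite -ltNge.
have : L - \sum_i a i * P_ k i < eps.
  rewrite /L -sumrB; apply: (@le_lt_trans _ _ (\sum_i `|a i| * (eps / C))).
    apply: ler_sum => i _; rewrite -mulrBr (le_trans (ler_norm _))// normrM.
    rewrite ler_wpM2l//; apply: ltW.
    by case: vu => _ /(_ ord0 (enum_rank i)); rewrite mxE enum_rankK.
  by rewrite -mulr_suml mulrCA gtr_pMr// ltr_pdivrMr// mul1r /C ltrDr.
rewrite /eps; lra.
Qed.

End Compactness.

(** * Information and support reduction *)

Section Information.
Variables (R : realType) (X W : finType).
Implicit Types P : X -> W -> R.

(** Mutual information in nats; dividing by [ln 2] gives bits. *)
Definition info P : R := \sum_x \sum_w
  P x w * ln (P x w / ((\sum_w' P x w') * (\sum_x' P x' w))).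

Section Joint.
Variable P : X -> W -> R.
Hypothesis P0 : forall x w, 0 <= P x w.

Lemma row_gt0 x w : P x w != 0 -> 0 < \sum_w' P x w'.
Proof.
move=> Pxw; rewrite (bigD1 w) //= ltr_wpDr//; first by rewrite sumr_ge0.
by rewrite lt0r Pxw P0.
Qed.

Lemma col_gt0 x w : P x w != 0 -> 0 < \sum_x' P x' w.
Proof.
move=> Pxw; rewrite (bigD1 x) //= ltr_wpDr//; first by rewrite sumr_ge0.
by rewrite lt0r Pxw P0.
Qed.

Hypothesis P1 : \sum_x \sum_w P x w = 1.

(** Applying [ln t <= t - 1] to the inverse ratio bounds each summand below by the joint mass minus
    the product of the marginals, and these differences sum to 0. *)
Lemma info_ge0 : 0 <= info P.
Proof.
have -> : 0 = \sum_x \sum_w (P x w - (\sum_w' P x w') * (\sum_x' P x' w)).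
  transitivity (\sum_x (\sum_w P x w - (\sum_w' P x w') * 1)).
    by under eq_bigr do rewrite mulr1 subrr; rewrite big1.
  apply: eq_bigr => x _; rewrite sumrB -mulr_sumr; congr (_ - _ * _).
  by rewrite exchange_big.
apply: ler_sum => x _; apply: ler_sum => w _.
have [->|Pxw] := eqVneq (P x w) 0.
  by rewrite mul0r sub0r oppr_le0 mulr_ge0// sumr_ge0.
have a0 := row_gt0 Pxw; have b0 := col_gt0 Pxw.
have Pxw0 : 0 < P x w by rewrite lt0r Pxw P0.
set a := \sum_w' _ in a0 *; set b := \sum_x' _ in b0 *.
rewrite -[P x w / _]invf_div lnV ?posrE ?divr_gt0 ?mulr_gt0//.
have : P x w * ln (a * b / P x w) <= P x w * (a * b / P x w - 1).
  by rewrite ler_wpM2l// ln_le_sub1// divr_gt0// mulr_gt0.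
by rewrite mulrBr [P x w * (_ / _)]mulrC divfK ?gt_eqF// mulr1; lra.
Qed.

(* The supremum over [rr] is attained at the backward channel of [P]; mixing it
   with the uniform law makes it positive at an arbitrarily small cost. *)
Lemma info_le_tests (b : R) :
  (forall rr : X -> W -> R, (forall x w, 0 < rr x w) ->
    (forall w, \sum_x rr x w <= 1) ->
    \sum_x \sum_w P x w * ln (rr x w / \sum_w' P x w') <= b) ->
  info P <= b.
Proof.
move=> tests; apply/ler_addgt0Pr => e e0; rewrite -lerBlDr.
have E1 : expR (- e) < 1 by rewrite expR_lt1 oppr_lt0.
have E0 : 0 < expR (- e) by exact: expR_gt0.
have X0 : 0 < #|X|%:R :> R.
  rewrite ltr0n; apply/card_gt0P.
  case: (pickP (fun _ : X => true)) => [x _|no]; first by exists x.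
  by move/eqP: P1; rewrite big1 ?(eq_sym 0) ?oner_eq0// => x; have := no x.
(* The weight [expR (- e)] on the backward channel lowers the logarithm by at most [e]. On a null
   column only the uniform part remains, with total below 1. *)
pose rr x w := expR (- e) * (P x w / \sum_x' P x' w) + (1 - expR (- e)) / #|X|%:R.
apply: le_trans (tests rr _ _).
- rewrite -[e]mulr1 -{1}P1 mulr_sumr -sumrB; apply: ler_sum => x _.
  rewrite mulr_sumr -sumrB; apply: ler_sum => w _.
  have [->|Pxw] := eqVneq (P x w) 0; first by rewrite !mul0r mulr0 subr0.
  have a0 := row_gt0 Pxw; have b0 := col_gt0 Pxw.
  have Pxw0 : 0 < P x w by rewrite lt0r Pxw P0.
  rewrite [e * _]mulrC -mulrBr ler_pM2l//.
  have q0 : 0 < P x w / ((\sum_w' P x w') * \sum_x' P x' w) by rewrite divr_gt0 ?mulr_gt0.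
  have r0 : expR (- e) * (P x w / \sum_x' P x' w) <= rr x w.
    by rewrite /rr lerDl divr_ge0// subr_ge0 ltW.
  have rr0 : 0 < rr x w / \sum_w' P x w'.
    by rewrite divr_gt0// (lt_le_trans _ r0)// mulr_gt0// divr_gt0.
  rewrite -{1}(expRK (- e)) addrC -lnM ?posrE//.
  rewrite ler_ln; [|by rewrite posrE mulr_gt0|by []].
  rewrite ler_pdivlMr// (le_trans _ r0)// -mulrA ler_pM2l//.
  by rewrite invfM mulrA mulrAC divfK ?gt_eqF.
- move=> x w; rewrite /rr ltr_wpDl//; last by rewrite divr_gt0// subr_gt0.
  by rewrite mulr_ge0 ?(ltW E0)// divr_ge0// sumr_ge0.
move=> w; rewrite /rr big_split /= -mulr_sumr -mulr_suml sumr_const.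
rewrite -[_ *+ #|X|]mulr_natr divfK ?gt_eqF//.
have [->|b0] := eqVneq (\sum_x P x w) 0; first by rewrite mul0r mulr0 add0r; lra.
by rewrite divff// mulr1 addrC subrK.
Qed.

End Joint.
End Information.

Section SupportReduction.
Variables (R : realType) (W J : finType) (v : W -> J -> R).

(** More than [#|J|] vectors of length [#|J|] have a nontrivial linear relation, here extended by 0
    outside [B]. *)
Lemma linear_dependence (B : {set W}) : (#|J| < #|B|)%N ->
  exists u : W -> R, [/\ forall w, w \notin B -> u w = 0, exists w, u w != 0 &
    forall j, \sum_w u w * v w j = 0].
Proof.
move=> JB; pose M := \matrix_(i < #|B|, j < #|J|) v (enum_val i) (enum_val j).
have /rowV0Pn[u0 /sub_kermxP u0M /rV0Pn[i0 u0i]] : kermx M != 0.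
  by rewrite -mxrank_eq0 mxrank_ker subn_eq0 -ltnNge (leq_ltn_trans (rank_leq_col _)).
pose u w := \sum_i u0 0 i * (enum_val i == w)%:R.
have uE phi : \sum_w u w * phi w = \sum_i u0 0 i * phi (enum_val i).
  under eq_bigr do rewrite mulr_suml.
  rewrite exchange_big /=; apply: eq_bigr => i _.
  rewrite (bigD1 (enum_val i)) //= eqxx mulr1 big1 ?addr0// => w.
  by rewrite eq_sym => /negbTE ->; rewrite mulr0 mul0r.
exists u; split.
- move=> w wB; rewrite /u big1// => i _; case: eqP => [e|]; last by rewrite mulr0.
  by move: wB; rewrite -e enum_valP.
- exists (enum_val i0); rewrite /u (bigD1 i0) //= eqxx mulr1 big1 ?addr0// => i ii0.
  by rewrite (inj_eq enum_val_inj) (negbTE ii0) mulr0.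
move=> j; rewrite uE.
have /rowP/(_ (enum_rank j)) := u0M; rewrite !mxE => e; rewrite -[RHS]e.
by apply: eq_bigr => i _; rewrite mxE enum_rankK.
Qed.

Variables (g rho : W -> R).
(** Dual form of [rho] being a linear combination of the constraints: a direction that preserves
    them preserves the [rho]-weighted total. *)
Hypothesis rho_span : forall u : W -> R,
  (forall j, \sum_w u w * v w j = 0) -> \sum_w u w * rho w = 0.

(* A basic optimal solution of the linear program of minimizing [g] under the
   constraints [v]; [rho_span] bounds the feasible set. *)
Lemma support_reduction (theta : W -> R) :
  (forall w, 0 <= theta w) -> (forall w, theta w != 0 -> 0 < rho w) ->
  exists theta' : W -> R,
    [/\ forall w, 0 <= theta' w,
        forall j, \sum_w theta' w * v w j = \sum_w theta w * v w j,
        \sum_w theta' w * g w <= \sum_w theta w * g w &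
        (#|[set w | theta' w != 0%R]| <= #|J|)%N].
Proof.
have [k] := ubnP #|[set w | theta w != 0]|.
elim: k theta => // k IH theta; rewrite ltnS => Bk theta0 rho0.
set B := [set w | theta w != 0] in Bk.
have [BJ|JB] := leqP #|B| #|J|; first by exists theta.
(* A relation or its opposite does not increase the objective. *)
have [u [uB [w1 uw1] uv ug]] : exists u : W -> R,
    [/\ forall w, w \notin B -> u w = 0, exists w, u w != 0,
      forall j, \sum_w u w * v w j = 0 & \sum_w u w * g w <= 0].
  have [u [uB [w1 uw1] uv]] := linear_dependence JB.
  have [ug|ug] := lerP (\sum_w u w * g w) 0; first by exists u; split => //; exists w1.
  exists (fun w => - u w); split.
  - by move=> w /uB ->; rewrite oppr0.
  - by exists w1; rewrite oppr_eq0.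
  - by move=> j; under eq_bigr do rewrite mulNr; rewrite sumrN uv oppr0.
  - by under eq_bigr do rewrite mulNr; rewrite sumrN oppr_le0 ltW.
(* Otherwise [u] is nonnegative with [rho]-weighted total 0, although [rho] is positive on [B], so
   [u] vanishes. *)
have [w0 uw0] : exists w0, u w0 < 0.
  apply/existsP; apply: contraT; rewrite negb_exists => /forallP u0.
  have urho w : 0 <= u w * rho w.
    have [wB|/uB ->] := boolP (w \in B); last by rewrite mul0r.
    by rewrite mulr_ge0// ?leNgt// -leNgt ltW// rho0//; move: wB; rewrite inE.
  have := rho_span uv => /eqP; rewrite psumr_eq0// => /allP /(_ w1).
  rewrite mem_index_enum => /(_ isT) /=; rewrite mulf_eq0 (negbTE uw1) /=.
  have : w1 \in B by apply: contraNT uw1 => /uB ->.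
  by rewrite inE => /rho0 /gt_eqF ->.
(* Ratio test: [ws] is a first coordinate to reach 0 along [u], which shrinks the support. *)
case: (@arg_minP _ R W w0 (fun w => u w < 0) (fun w => theta w / - u w) uw0) => ws us min_ws.
set t := theta ws / - u ws in min_ws.
have t0 : 0 <= t by rewrite divr_ge0// oppr_ge0 ltW.
pose theta1 w := theta w + t * u w.
have theta1B w : theta1 w != 0 -> w \in B.
  apply: contraR => wB; rewrite /theta1 (uB _ wB) mulr0 addr0.
  by move: wB; rewrite inE negbK.
have theta1_ge0 w : 0 <= theta1 w.
  have [uw|uw] := ltrP (u w) 0; last first.
    by apply: addr_ge0 => //; apply: mulr_ge0.
  have := min_ws w uw; rewrite ler_pdivlMr ?oppr_gt0// mulrN /theta1; lra.
have theta1_ws : theta1 ws = 0.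
  by rewrite /theta1 /t invrN mulrN mulNr divfK ?subrr// lt_eqF.
have usB : ws \in B by apply: contraT => /uB e; move: us; rewrite e ltxx.
have sumE phi : \sum_w theta1 w * phi w =
    \sum_w theta w * phi w + t * \sum_w u w * phi w.
  rewrite mulr_sumr -big_split /=; apply: eq_bigr => w _.
  by rewrite mulrDl mulrA.
have [||| theta' [th0 thv thg thJ]] := IH theta1.
- apply: leq_trans Bk; apply: proper_card; apply/properP; split.
    by apply/fintype.subsetP => w; rewrite inE; exact: theta1B.
  by exists ws => //; rewrite inE theta1_ws eqxx.
- exact: theta1_ge0.
- by move=> w /theta1B; rewrite inE; exact: rho0.
exists theta'; split => // [j|]; first by rewrite thv sumE uv mulr0 addr0.
by apply: le_trans thg _; rewrite sumE gerDl mulr_ge0_le0.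
Qed.

End SupportReduction.

(** * The single-letter joint law *)

Section ProbabilitySums.
Variables (R : realType) (Omega : finType) (P : fdist R Omega).

Lemma sum_marginal (T : finType) (V : Omega -> T) (g : T -> R) :
  \sum_t marginal P V t * g t = expect P (fun w => g (V w)).
Proof.
rewrite /expect (partition_big V predT) //=; apply: eq_bigr => t _.
by rewrite /marginal mulr_suml; apply: eq_bigr => w /eqP ->.
Qed.

Lemma marginalE (T : finType) (V : Omega -> T) t :
  marginal P V t = expect P (fun w => (V w == t)%:R).
Proof.
rewrite /marginal big_mkcond; apply: eq_bigr => w _.
by case: eqP; rewrite ?mulr1 ?mulr0.
Qed.

Lemma marginal_gt0 (T : finType) (V : Omega -> T) w :
  P w != 0 -> 0 < marginal P V (V w).
Proof.
move=> Pw; rewrite /marginal (bigD1 w) //= ltr_wpDr//.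
  by apply: sumr_ge0 => *; exact: fdist_ge0.
by rewrite lt0r Pw fdist_ge0.
Qed.

(** As means of densities, mutual informations can be added under one expectation. *)
Lemma mutual_infoE (T V : finType) (F : Omega -> T) (H : Omega -> V) :
  mutual_info P F H = expect P (fun w =>
    log2 (marginal P (fun w => (F w, H w)) (F w, H w) /
      (marginal P F (F w) * marginal P H (H w)))).
Proof.
rewrite -(sum_marginal (fun w => (F w, H w)) (fun p =>
  log2 (marginal P (fun w => (F w, H w)) p /
      (marginal P F p.1 * marginal P H p.2)))).
by rewrite /mutual_info pair_bigA; apply: eq_bigr => -[].
Qed.

Lemma cond_mutual_infoE (T V K : finType)
    (F : Omega -> T) (H : Omega -> V) (C : Omega -> K) :
  cond_mutual_info P F H C = expect P (fun w =>
    log2 (marginal P C (C w) * marginal P (fun w => (F w, H w, C w)) (F w, H w, C w) /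
      (marginal P (fun w => (F w, C w)) (F w, C w) *
       marginal P (fun w => (H w, C w)) (H w, C w)))).
Proof.
rewrite -(sum_marginal (fun w => (F w, H w, C w)) (fun p =>
  log2 (marginal P C p.2 * marginal P (fun w => (F w, H w, C w)) p /
      (marginal P (fun w => (F w, C w)) (p.1.1, p.2) *
       marginal P (fun w => (H w, C w)) (p.1.2, p.2))))).
by rewrite /cond_mutual_info !pair_bigA; apply: eq_bigr => -[[]].
Qed.

End ProbabilitySums.

Section SingleLetterJoint.
Variables (R : realType) (X Y Z A T1 T2 Th1 Th2 : finType).
Variable S : problem R X Y Z A T1 T2 Th1 Th2.
Variables (U : finType) (q : X -> fdist R (A * U * Th1)%type).
Variable that2 : U -> Z -> Th2.

Local Notation W := (A * U * Th1)%type.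
Local Notation space := (X * Y * Z * U * A * Th1 * Th2)%type.

Definition actW (w : W) : A := w.1.1.

Definition rvW (w : space) : W := (rvA w, rvU w, rvTh1 w).

Definition xw_mass (x : X) (w : W) : R := pX S x * q x w.

Lemma joint_expect (V : space -> R) : expect (joint S q that2) V =
  \sum_x \sum_y \sum_z \sum_(w : W)
    src S (x, y) * meas S (actW w) x y z * q x w *
    V (x, y, z, w.1.2, w.1.1, w.2, that2 w.1.2 z).
Proof.
transitivity (\sum_x \sum_y \sum_z \sum_u \sum_a \sum_t1 \sum_t2
    joint_mass S q that2 (x, y, z, u, a, t1, t2) * V (x, y, z, u, a, t1, t2)).
  by rewrite !pair_bigA /=; apply: eq_bigr => -[[[[[[x y] z] u] a] t1] t2] _.
apply: eq_bigr => x _; apply: eq_bigr => y _; apply: eq_bigr => z _.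
rewrite exchange_big !pair_bigA /=.
rewrite -(pair_bigA _ (fun (w : W) (t2 : Th2) => src S (x, y) * meas S w.1.1 x y z *
  q x (w.1.1, w.1.2, w.2) * (t2 == that2 w.1.2 z)%:R * V (x, y, z, w.1.2, w.1.1, w.2, t2))) /=.
apply: eq_bigr => -[[a u] t1] _ /=.
rewrite (bigD1 (that2 u z)) //= eqxx mulr1 big1 ?addr0// => t2 /negbTE ->.
by rewrite mulr0 mul0r.
Qed.

Lemma joint_expect_loss (phi : W -> X -> Y -> Z -> R) :
  expect (joint S q that2) (fun '(x, y, z, u, a, t1, t2) => phi (a, u, t1) x y z) =
  \sum_x \sum_w xw_mass x w * cond_loss S actW phi x w.
Proof.
rewrite joint_expect; apply: eq_bigr => x _.
under eq_bigr do rewrite exchange_big /=.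
rewrite exchange_big /=; apply: eq_bigr => w _.
rewrite /xw_mass mulrAC pX_cond_loss mulr_suml; apply: eq_bigr => y _.
rewrite mulr_suml; apply: eq_bigr => z _.
by rewrite mulrAC -!surjective_pairing.
Qed.

Lemma joint_expect_xw (phi : X -> W -> R) :
  expect (joint S q that2) (fun w => phi (rvX w) (rvW w)) =
  \sum_x \sum_w xw_mass x w * phi x w.
Proof.
transitivity (expect (joint S q that2)
  (fun '(x, y, z, u, a, t1, t2) => phi x (a, u, t1))).
  by apply: eq_bigr => -[[[[[[x y] z] u] a] t1] t2].
rewrite (joint_expect_loss (fun w x y z => phi x w)); apply: eq_bigr => x _.
apply: eq_bigr => w _; rewrite /xw_mass 2!(mulrAC _ (q x w)) pX_cond_loss; congr (_ * _).
rewrite -(sum_src_meas S x (actW w)) pair_bigA mulr_suml /=.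
by apply: eq_bigr => -[].
Qed.

Lemma xw_mass_ge0 x w : 0 <= xw_mass x w.
Proof. by rewrite mulr_ge0 ?pX_ge0 ?fdist_ge0. Qed.

Lemma xw_mass_row x : \sum_w xw_mass x w = pX S x.
Proof. by rewrite -mulr_sumr fdist_sum1 mulr1. Qed.

Lemma marginal_xw (T : finType) (V : X -> W -> T) t :
  marginal (joint S q that2) (fun w => V (rvX w) (rvW w)) t =
  \sum_x \sum_w xw_mass x w * (V x w == t)%:R.
Proof. by rewrite marginalE (joint_expect_xw (fun x w => (V x w == t)%:R)). Qed.

Lemma marginal_rvX x :
  marginal (joint S q that2) (@rvX X Y Z A Th1 Th2 U) x = \sum_w xw_mass x w.
Proof.
rewrite (marginal_xw (fun x w => x)) (bigD1 x) //= eqxx [X in _ + X]big1 ?addr0.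
  by under eq_bigr do rewrite mulr1.
by move=> x' /negbTE ->; rewrite big1// => w _; rewrite mulr0.
Qed.

Lemma marginal_rvW w : marginal (joint S q that2) rvW w = \sum_x xw_mass x w.
Proof.
rewrite (marginal_xw (fun x w => w)); apply: eq_bigr => x _.
rewrite (bigD1 w) //= eqxx mulr1 big1 ?addr0// => w' /negbTE ->.
by rewrite mulr0.
Qed.

Lemma marginal_rvXW x w :
  marginal (joint S q that2) (fun w => (rvX w, rvW w)) (x, w) = xw_mass x w.
Proof.
rewrite (marginal_xw (fun x w => (x, w))) pair_bigA (bigD1 (x, w)) //= eqxx mulr1.
rewrite big1 ?addr0// => -[x' w'] /negbTE /= ->.
by rewrite mulr0.
Qed.

(* The chain rule, which holds pointwise for the information densities. *)
Lemma info_rateE : info_rate S q that2 = info xw_mass / ln 2.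
Proof.
set Q := joint S q that2.
transitivity (expect Q (fun w => ln (xw_mass (rvX w) (rvW w) /
    ((\sum_w' xw_mass (rvX w) w') * (\sum_x' xw_mass x' (rvW w)))) / ln 2));
  last first.
  rewrite (joint_expect_xw (fun x w => ln (xw_mass x w /
    ((\sum_w' xw_mass x w') * (\sum_x' xw_mass x' w))) / ln 2)) /info mulr_suml.
  apply: eq_bigr => x _; rewrite mulr_suml; apply: eq_bigr => w _.
  by rewrite mulrA.
rewrite /info_rate mutual_infoE !cond_mutual_infoE /expect -!big_split /=.
apply: eq_bigr => w _; rewrite -!mulrDr -[joint_mass _ _ _ w]/(Q w).
have [->|Qw] := eqVneq (Q w) 0; first by rewrite !mul0r.
congr (_ * _); rewrite -marginal_rvX -marginal_rvW -marginal_rvXW -/Q.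
have -> : marginal Q (fun w => (rvX w, rvW w)) (rvX w, rvW w) =
    marginal Q (fun w => (rvX w, rvU w, (rvA w, rvTh1 w))) (rvX w, rvU w, (rvA w, rvTh1 w)).
  apply: eq_bigl => w'; rewrite /rvW !xpair_eqE.
  by do !case: (_ == _).
have -> : marginal Q rvW (rvW w) =
    marginal Q (fun w => (rvU w, (rvA w, rvTh1 w))) (rvU w, (rvA w, rvTh1 w)).
  by apply: eq_bigl => w'; rewrite /rvW !xpair_eqE; do !case: (_ == _).
have -> : marginal Q (fun w => (rvX w, (rvA w, rvTh1 w))) (rvX w, (rvA w, rvTh1 w)) =
    marginal Q (fun w => (rvX w, rvTh1 w, rvA w)) (rvX w, rvTh1 w, rvA w).
  by apply: eq_bigl => w'; rewrite !xpair_eqE; do !case: (_ == _).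
have -> : marginal Q (fun w => (rvA w, rvTh1 w)) (rvA w, rvTh1 w) =
    marginal Q (fun w => (rvTh1 w, rvA w)) (rvTh1 w, rvA w).
  by apply: eq_bigl => w'; rewrite !xpair_eqE; do !case: (_ == _).
(* Every marginal is positive at an outcome of positive mass, so the logarithms split and
   telescope. *)
rewrite /log2 -!mulrDl; congr (_ / _).
have m1 := marginal_gt0 (@rvX X Y Z A Th1 Th2 U) Qw.
have m2 := marginal_gt0 (@rvA X Y Z A Th1 Th2 U) Qw.
have m3 := marginal_gt0 (fun w : space => (rvX w, rvA w)) Qw.
have m4 := marginal_gt0 (fun w : space => (rvX w, rvTh1 w, rvA w)) Qw.
have m5 := marginal_gt0 (fun w : space => (rvTh1 w, rvA w)) Qw.
have m6 := marginal_gt0 (fun w : space => (rvX w, rvU w, (rvA w, rvTh1 w))) Qw.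
have m7 := marginal_gt0 (fun w : space => (rvU w, (rvA w, rvTh1 w))) Qw.
rewrite !ln_div ?posrE ?mulr_gt0// !lnM ?posrE//.
ring.
Qed.

End SingleLetterJoint.

(** * Random coding *)

Section RandomCoding.
Variable R : realType.

(** From [1 - u <= expR (- u)] one gets [expR u * (1 - u) <= 1], while the right-hand side times
    [1 - u] is [1 + u ^+ 2 * (1 - 2 * u)]. *)
Lemma expR_le_quadratic (u : R) : `|u| <= 2^-1 -> expR u <= 1 + u + 2 * u ^+ 2.
Proof.
move=> /ler_normlP [u1 u2].
have e1 := @expR_ge1Dx R (- u); have E0 := @expR_gt0 R u.
have : expR u * (1 - u) <= 1.
  by rewrite -[leRHS](expRxMexpNx_1 u) ler_pM2l.
have u3 : 0 <= u ^+ 2 * (1 - 2 * u) by rewrite mulr_ge0 ?sqr_ge0//; lra.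
have u4 : 0 < 1 - u by lra.
move=> le1; rewrite -(ler_pM2r u4) (le_trans le1)//.
have -> : (1 + u + 2 * u ^+ 2) * (1 - u) = 1 + u ^+ 2 * (1 - 2 * u) by ring.
by rewrite lerDl.
Qed.

Lemma expR_eventually_le (kappa delta : R) : 0 < kappa -> 0 < delta ->
  exists n0 : nat, forall n, (n0 <= n)%N -> expR (- (kappa * n%:R)) <= delta.
Proof.
move=> k0 d0; exists (Num.truncn (kappa * delta)^-1).+1 => n n0.
rewrite expRN -[leRHS]invrK lef_pV2 ?posrE ?expR_gt0 ?invr_gt0//.
have kE : kappa * n%:R <= expR (kappa * n%:R).
  by have := @expR_ge1Dx R (kappa * n%:R); lra.
apply: le_trans kE; rewrite -ler_pdivrMl// -invfM; apply: ltW.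
by apply: lt_le_trans (truncnS_gt _) _; rewrite ler_nat.
Qed.

(** Exponential Markov inequality with one parameter [t0] for all [k]. Half of the exponent
    [t0 * eta] pays for the quadratic term of [expR]; the other half is [kappa]. *)
Lemma chernoff (K T : finType) (P : T -> R) (f : K -> T -> R) (eta : R) :
  (forall t, 0 <= P t) -> \sum_t P t = 1 -> 0 < eta ->
  exists2 kappa, 0 < kappa & forall k n,
    \sum_(s : {ffun 'I_n -> T}) (\prod_i P (s i)) *
      (n%:R * (\sum_t P t * f k t + eta) < \sum_i f k (s i))%R%:R
    <= expR (- (kappa * n%:R)).
Proof.
move=> P0 P1 eta0; pose mu k := \sum_t P t * f k t.
pose B := 1 + \sum_k \sum_t `|f k t - mu k|.
have B0 : 0 < B.
  by rewrite ltr_pwDl// sumr_ge0// => k _; rewrite sumr_ge0.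
have fB k t : `|f k t - mu k| <= B.
  apply: (@le_trans _ _ (\sum_t `|f k t - mu k|)).
    by rewrite (bigD1 t) //= lerDl sumr_ge0.
  rewrite /B (bigD1 k) //= addrCA lerDl addr_ge0// sumr_ge0// => k' _.
  by rewrite sumr_ge0.
(* The two summands of the denominator give [2 * t0 * B ^+ 2 <= eta / 2] and [t0 * B <= 1 / 2]. *)
pose t0 := eta / (4 * B ^+ 2 + 2 * B * eta).
have den0 : 0 < 4 * B ^+ 2 + 2 * B * eta by rewrite addr_gt0 ?mulr_gt0 ?exprn_gt0.
have t00 : 0 < t0 by rewrite divr_gt0.
have [B0' t00' eta0'] := And3 (ltW B0) (ltW t00) (ltW eta0).
have t0E : t0 * (4 * B ^+ 2) + t0 * (2 * B * eta) = eta.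
  by rewrite -mulrDr divfK// gt_eqF.
clearbody t0; clear den0; clearbody B.
have tB : t0 * B <= 2^-1.
  rewrite -(ler_pM2r eta0).
  have : 0 <= t0 * (4 * B ^+ 2) by rewrite !mulr_ge0 ?exprn_ge0 ?ler0n.
  rewrite mulrC; lra.
have tB2 : 2 * t0 * B ^+ 2 <= eta / 2.
  have : 0 <= t0 * (2 * B * eta) by rewrite !mulr_ge0 ?exprn_ge0 ?ler0n.
  by lra.
exists (t0 * eta / 2); first by rewrite divr_gt0// mulr_gt0.
move=> k n.
apply: (@le_trans _ _ (\sum_(s : {ffun 'I_n -> T})
    \prod_i (P (s i) * expR (t0 * (f k (s i) - mu k - eta))))).
  apply: ler_sum => s _; rewrite big_split /= ler_wpM2l ?prodr_ge0//.
  rewrite -expR_sum -mulr_sumr !sumrB !sumr_const card_ord.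
  case: ltrP => [lt|_]; last exact: expR_ge0.
  rewrite -[leLHS]expR0 ler_expR mulr_ge0//.
  rewrite -[mu k *+ n]mulr_natl -[eta *+ n]mulr_natl -addrA -opprD -mulrDr subr_ge0.
  exact: ltW.
rewrite (sum_prod_ffun (fun _ t => P t * expR (t0 * (f k t - mu k - eta)))).
rewrite prodr_const card_ord mulrC -mulrN expRM_natl.
apply: lerXn2r; rewrite ?nnegrE ?expR_ge0 ?sumr_ge0//.
  by move=> t _; rewrite mulr_ge0// expR_ge0.
under eq_bigr do rewrite mulrBr expRB mulrA.
rewrite -mulr_suml -expRN.
have -> : expR (- (t0 * eta / 2)) = expR (t0 * eta / 2) * expR (- (t0 * eta)).
  by rewrite -expRD; congr expR; lra.
rewrite ler_pM2r ?expR_gt0//.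
apply: le_trans (expR_ge1Dx _).
have -> : 1 + t0 * eta / 2 = \sum_t P t * (1 + t0 * (f k t - mu k) + t0 * eta / 2).
  rewrite [RHS](eq_bigr (fun t => t0 * (P t * f k t) +
    (1 + t0 * eta / 2 - t0 * mu k) * P t)); last by move=> t _; ring.
  by rewrite big_split /= -!mulr_sumr P1 -/(mu k); ring.
apply: ler_sum => t _; rewrite ler_wpM2l//.
have g1 : `|t0 * (f k t - mu k)| <= t0 * B.
  by rewrite normrM gtr0_norm// ler_pM2l.
apply: le_trans (expR_le_quadratic (le_trans g1 tB)) _.
rewrite lerD2l -real_normK ?num_real//.
have : `|t0 * (f k t - mu k)| ^+ 2 <= (t0 * B) ^+ 2.
  by apply: lerXn2r; rewrite ?nnegrE// mulr_ge0// ltW.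
have : t0 * (2 * t0 * B ^+ 2) <= t0 * (eta / 2) by rewrite ler_pM2l.
by rewrite exprMn expr2; lra.
Qed.

Lemma exists_le_average (I : finType) (p F : I -> R) (b : R) :
  (forall i, 0 <= p i) -> \sum_i p i = 1 -> \sum_i p i * F i <= b ->
  exists i, F i <= b.
Proof.
move=> p0 p1 pb; apply/existsP; apply: contraT; rewrite negb_exists => /forallP Fb.
have : \sum_i p i * (F i - b) <= 0.
  under eq_bigr do rewrite mulrBr.
  by rewrite sumrB -mulr_suml p1 mul1r subr_le0.
have Fb0 i : 0 <= p i * (F i - b).
  by rewrite mulr_ge0// subr_ge0 ltW// ltNge Fb.
rewrite le_eqVlt ltNge sumr_ge0 ?orbF// psumr_eq0// => /allP all0.
suff : \sum_i p i = 0 by rewrite p1 => /eqP; rewrite oner_eq0.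
rewrite big1// => i _; have := all0 i (mem_index_enum _) => /=.
rewrite mulf_eq0 => /orP[/eqP//|]; rewrite subr_eq0 => /eqP Fi.
by have := Fb i; rewrite Fi lexx.
Qed.

(* With [beta x] the conditional probability of [good] given [x], an independent
   codeword is good with probability at least [alpha * beta x], so [N] of them
   all miss with probability at most [exp (- alpha * N / 2)] if
   [beta x >= 1/2], and [1 <= 2 * (1 - beta x)] otherwise. *)
Lemma covering (Xs Ws : finType) (px : Xs -> R) (pw : Ws -> R) (Pj : Xs -> Ws -> R)
    (good : Xs -> Ws -> bool) (alpha : R) (N : nat) :
  \sum_x px x = 1 -> (forall w, 0 <= pw w) -> \sum_w pw w = 1 ->
  (forall x w, 0 <= Pj x w) -> (forall x, \sum_w Pj x w = px x) -> 0 <= alpha ->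
  (forall x w, good x w -> alpha * Pj x w <= px x * pw w) ->
  exists cb : {ffun 'I_N -> Ws},
    \sum_x px x * [forall m, ~~ good x (cb m)]%:R <=
    2 * (\sum_x \sum_w Pj x w * (~~ good x w)%:R) + expR (- (alpha * N%:R / 2)).
Proof.
move=> px1 pw0 pw1 Pj0 Pjx alpha0 goodP.
have px0 x : 0 <= px x by rewrite -Pjx sumr_ge0.
apply: (@exists_le_average _ (fun cb : {ffun 'I_N -> Ws} => \prod_m pw (cb m))).
- by move=> cb; apply: prodr_ge0.
- by rewrite (sum_prod_ffun (fun=> pw)) big1.
under eq_bigr do rewrite mulr_sumr.
rewrite exchange_big /=.
set e := expR (- (alpha * N%:R / 2)).
have eE : e = \sum_x px x * e by rewrite -mulr_suml px1 mul1r.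
rewrite [X in _ <= _ + X]eE mulr_sumr -big_split /=; apply: ler_sum => x _.
pose Q := \sum_w pw w * (good x w)%:R.
have -> : \sum_(cb : {ffun 'I_N -> Ws}) (\prod_m pw (cb m)) *
    (px x * [forall m, ~~ good x (cb m)]%:R) = px x * (1 - Q) ^+ N.
  transitivity (px x * \sum_(cb : {ffun 'I_N -> Ws})
      \prod_m (pw (cb m) * (~~ good x (cb m))%:R)).
    rewrite mulr_sumr; apply: eq_bigr => cb _; rewrite mulrCA; congr (_ * _).
    rewrite big_split /=; congr (_ * _).
    case: (boolP [forall m, _]) => [/forallP all|].
      by rewrite big1// => m _; rewrite all.
    by rewrite negb_forall => /existsP[m /negbTE bad]; rewrite (bigD1 m) //= bad mul0r.
  rewrite (sum_prod_ffun (fun _ w => pw w * (~~ good x w)%:R)) prodr_const card_ord.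
  congr (_ * _ ^+ _); rewrite -[X in _ = X - _]pw1 -sumrB; apply: eq_bigr => w _.
  by case: (good x w); rewrite ?mulr1 ?mulr0 ?subrr ?subr0.
have Q01 : 0 <= Q <= 1.
  rewrite sumr_ge0 /= => [|w _]; last by rewrite mulr_ge0.
  rewrite -[leRHS]pw1; apply: ler_sum => w _.
  by case: (good x w); rewrite ?mulr1 ?mulr0.
(* Here [b] is [px x * (1 - beta x)], so the case split compares [beta x] with 1/2 without dividing
   by [px x]. *)
pose b := \sum_w Pj x w * (~~ good x w)%:R.
rewrite -/b; have b0 : 0 <= b by rewrite sumr_ge0// => w _; rewrite mulr_ge0.
have [bx|bx] := lerP (px x) (2 * b).
  apply: (@le_trans _ _ (px x * 1)); last by rewrite mulr1 ler_wpDr// mulr_ge0// expR_ge0.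
  by rewrite ler_wpM2l// exprn_ile1//; lra.
have px_gt0 : 0 < px x by apply: le_lt_trans bx; rewrite mulr_ge0.
rewrite ler_wpDl ?mulr_ge0// ler_pM2l// /e.
have alphaQ : alpha / 2 <= Q.
  rewrite -(ler_pM2l px_gt0).
  apply: (@le_trans _ _ (alpha * (px x - b))).
    by rewrite mulrCA ler_wpM2l//; lra.
  rewrite -[in leLHS]Pjx /b -sumrB !mulr_sumr; apply: ler_sum => w _.
  by have := goodP x w; case: (good x w) => /= [/(_ isT)|_];
    rewrite !(mulr1, mulr0, subr0, subrr).
apply: (@le_trans _ _ (expR (- Q) ^+ N)).
  apply: lerXn2r; rewrite ?nnegrE ?expR_ge0//; first by lra.
  exact: expR_ge1Dx.
rewrite -expRM_natl ler_expR mulrN lerN2 mulrAC mulrC.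
by rewrite ler_wpM2l.
Qed.

End RandomCoding.

Section GoodCodebooks.
Variables (R : realType) (X W K : finType) (P : X -> W -> R) (loss : K -> X -> W -> R).
Hypothesis P0 : forall x w, 0 <= P x w.
Hypothesis P1 : \sum_x \sum_w P x w = 1.

Let px x := \sum_w P x w.
Let pw w := \sum_x P x w.
Let mu k := \sum_x \sum_w P x w * loss k x w.

(* The last clause bounds the information density; in this multiplicative form it
   is meaningful where [P] vanishes. *)
Definition good_pair (eta : R) (n : nat) (x : {ffun 'I_n -> X}) (w : {ffun 'I_n -> W}) :=
  [forall k, \sum_i loss k (x i) (w i) <= n%:R * (mu k + eta)] &&
  (\prod_i P (x i) (w i) <=
     expR (n%:R * (info P + eta)) * \prod_i (px (x i) * pw (w i))).

(** Union bound over the losses and the information density, which [None] indexes: each is a sum of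
    i.i.d. terms under the product law. *)
Lemma good_pair_prob (eta : R) : 0 < eta -> exists2 kappa, 0 < kappa &
  forall n, \sum_(x : {ffun 'I_n -> X}) \sum_(w : {ffun 'I_n -> W})
    (\prod_i P (x i) (w i)) * (~~ good_pair eta x w)%:R
  <= #|{: option K}|%:R * expR (- (kappa * n%:R)).
Proof.
move=> eta0.
pose f (k : option K) (t : X * W) := if k is Some k' then loss k' t.1 t.2
  else ln (P t.1 t.2 / (px t.1 * pw t.2)).
have P1' : \sum_(t : X * W) P t.1 t.2 = 1 by rewrite -P1 pair_bigA.
have [kappa kappa0 kappaP] := chernoff f (fun t => P0 t.1 t.2) P1' eta0.
exists kappa => // n.
have fmu k : \sum_(t : X * W) P t.1 t.2 * f k t = if k is Some k' then mu k' else info P.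
  by case: k => [k|] /=; rewrite /mu /info pair_bigA.
apply: (@le_trans _ _ (\sum_(k : option K) expR (- (kappa * n%:R)))); last first.
  by rewrite sumr_const -[_ *+ _]mulr_natl.
apply: le_trans (ler_sum _ (fun k _ => kappaP k n)).
rewrite [leRHS]exchange_big /=.
rewrite (sum_ffun_pair (fun x w => (\prod_i P (x i) (w i)) * (~~ good_pair eta x w)%:R)).
apply: ler_sum => s _; rewrite -mulr_sumr.
have -> : \prod_i P ([ffun j => (s j).1] i) ([ffun j => (s j).2] i) =
    \prod_i P (s i).1 (s i).2 by apply: eq_bigr => i _; rewrite !ffunE.
have [->|prod0] := eqVneq (\prod_i P (s i).1 (s i).2) 0; first by rewrite !mul0r.
rewrite ler_wpM2l ?prodr_ge0//.
case: (boolP (good_pair _ _ _)) => [_|]; first by rewrite sumr_ge0.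
rewrite negb_and negb_forall => bad.
suff [k lt] : exists k : option K,
    n%:R * (\sum_t P t.1 t.2 * f k t + eta) < \sum_i f k (s i).
  by rewrite (bigD1 k) //= lt lerDl sumr_ge0.
case/orP: bad => [/existsP[k]|].
  rewrite -ltNge => lt; exists (Some k); rewrite fmu /=.
  apply: lt_le_trans lt _; apply: ler_sum => i _.
  by rewrite !ffunE.
rewrite -ltNge => lt; exists None; rewrite fmu /=.
have Ps i : P (s i).1 (s i).2 != 0.
  by apply: contra prod0 => /eqP e; rewrite (bigD1 i) //= e mul0r.
have px0 i : 0 < px (s i).1 := row_gt0 P0 (Ps i).
have pw0 i : 0 < pw (s i).2 := col_gt0 P0 (Ps i).
have PP i : 0 < P (s i).1 (s i).2 by rewrite lt0r Ps P0.
rewrite -ltr_expR expR_sum.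
have -> : \prod_i expR (ln (P (s i).1 (s i).2 / (px (s i).1 * pw (s i).2))) =
    (\prod_i P (s i).1 (s i).2) / \prod_i (px (s i).1 * pw (s i).2).
  rewrite -prodf_div; apply: eq_bigr => i _.
  by rewrite lnK// posrE divr_gt0// mulr_gt0.
rewrite ltr_pdivlMr; last by apply: prodr_gt0 => i _; rewrite mulr_gt0.
have pE : \prod_i (px (s i).1 * pw (s i).2) =
    \prod_i (px ([ffun j => (s j).1] i) * pw ([ffun j => (s j).2] i)).
  by apply: eq_bigr => i _; rewrite !ffunE.
have PE : \prod_i P (s i).1 (s i).2 =
    \prod_i P ([ffun j => (s j).1] i) ([ffun j => (s j).2] i).
  by apply: eq_bigr => i _; rewrite !ffunE.
by rewrite pE PE.
Qed.

Lemma nb_messages_gt (n : nat) (r : R) :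
  expR (n%:R * r * ln 2) - 1 < (nb_messages n r)%:R.
Proof.
have <- : 2 `^ (n%:R * r) = expR (n%:R * r * ln 2) by rewrite /powR pnatr_eq0.
by rewrite ltrBlDr natr1 truncnS_gt.
Qed.

(** The covering lemma is used with good pairs, so one codebook controls all the losses at once. *)
Lemma good_codebooks (r eps : R) :
  (forall k x w, 0 <= loss k x w) -> info P < r * ln 2 -> 0 < eps ->
  exists n0, forall n, (n0 <= n)%N ->
    exists (enc : {ffun 'I_n -> X} -> 'I_(nb_messages n r))
           (cb : 'I_(nb_messages n r) -> {ffun 'I_n -> W}),
      forall k, n%:R^-1 * \sum_(i < n) \sum_(x : {ffun 'I_n -> X})
        (\prod_j px (x j)) * loss k (x i) (cb (enc x) i) <= mu k + eps.
Proof.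
move=> loss0 Ir eps0.
pose L := 1 + \sum_k \sum_x \sum_w loss k x w.
have L0 : 0 < L.
  by rewrite ltr_pwDl// sumr_ge0// => k _; rewrite sumr_ge0// => x _; rewrite sumr_ge0.
have lossL k x w : loss k x w <= L.
  apply: (@le_trans _ _ (\sum_k \sum_x \sum_w loss k x w)); last by rewrite lerDr.
  rewrite (bigD1 k) //= (bigD1 x) //= (bigD1 w) //= -!addrA lerDl !addr_ge0 ?sumr_ge0//.
    by move=> ? _; rewrite sumr_ge0.
  by move=> ? _; rewrite sumr_ge0// => ? _; rewrite sumr_ge0.
(* Half of [eps] is for typical sequences. The rate gap holds [eta] twice: once for the slack in the
   information density, once for the growth of [alpha * N]. *)
have [eta [eta0 eta_eps eta_r]] : exists eta : R,
    [/\ 0 < eta, eta <= eps / 2 & info P + eta + eta <= r * ln 2].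
  have [le|le] := lerP (eps / 2) ((r * ln 2 - info P) / 2).
    by exists (eps / 2); split; lra.
  by exists ((r * ln 2 - info P) / 2); split; lra.
(* Covering failures, of probability at most [delta], cost at most [L * delta = eps / 2]. *)
pose delta := eps / (2 * L).
have delta0 : 0 < delta by rewrite divr_gt0// mulr_gt0.
have [kappa kappa0 kappaP] := good_pair_prob eta0.
pose C : R := #|{: option K}|%:R.
have C0 : 0 < C by rewrite ltr0n card_option.
have [|n1 n1P] := @expR_eventually_le R kappa (delta / (4 * C)) kappa0.
  by rewrite divr_gt0// mulr_gt0.
have [||n2 n2P] := @expR_eventually_le R (eta / 2) (delta / 2).
- by rewrite divr_gt0.
- by rewrite divr_gt0.
exists (maxn 1 (maxn n1 n2)) => n; rewrite !geq_max => /and3P[n_gt0 n1n n2n].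
have nR : 0 < n%:R :> R by rewrite ltr0n.
set N := nb_messages n r.
pose alpha := expR (- (n%:R * (info P + eta))).
have I0 := info_ge0 P0 P1.
have N_gt0 : (0 < N)%N.
  rewrite -(ltr0n R); apply: le_lt_trans (nb_messages_gt n r).
  rewrite subr_ge0 -[leLHS]expR0 ler_expR -mulrA mulr_ge0// ltW//.
  exact: le_lt_trans Ir.
have alphaN : n%:R * eta <= alpha * N%:R.
  apply: (@le_trans _ _ (expR (n%:R * eta) - 1)).
    by have := @expR_ge1Dx R (n%:R * eta); lra.
  apply: (@le_trans _ _ (alpha * (expR (n%:R * r * ln 2) - 1))); last first.
    by rewrite ler_wpM2l ?expR_ge0// ltW// nb_messages_gt.
  rewrite mulrBr mulr1 -expRD; apply: lerB.
    by rewrite ler_expR -mulrA -mulrN -mulrDr ler_wpM2l//; lra.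
  by rewrite expR_le1 oppr_le0 mulr_ge0// addr_ge0// ltW.
pose pxn (x : {ffun 'I_n -> X}) := \prod_i px (x i).
pose pwn (w : {ffun 'I_n -> W}) := \prod_i pw (w i).
pose Pn (x : {ffun 'I_n -> X}) (w : {ffun 'I_n -> W}) := \prod_i P (x i) (w i).
have pw0 w : 0 <= pw w by rewrite sumr_ge0.
have px0 x : 0 <= px x by rewrite sumr_ge0.
have pxn1 : \sum_x pxn x = 1 by apply: sum_prod_eq1.
have [cb cbP] : exists cb : {ffun 'I_N -> {ffun 'I_n -> W}},
    \sum_x pxn x * [forall m, ~~ good_pair eta x (cb m)]%:R <= delta.
  have [||||||cb cbP] := @covering R _ _ pxn pwn Pn (@good_pair eta n) alpha N pxn1.
  - by move=> w; apply: prodr_ge0.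
  - by apply: sum_prod_eq1; rewrite /pw exchange_big.
  - by move=> x w; apply: prodr_ge0.
  - by move=> x; rewrite /Pn (sum_prod_ffun (fun i => P (x i))).
  - exact: expR_ge0.
  - move=> x w /andP[_]; rewrite big_split /= => le.
    rewrite /alpha -(ler_pM2l (expR_gt0 (n%:R * (info P + eta)))) mulrA.
    by rewrite expRxMexpNx_1 mul1r.
  exists cb; apply: le_trans cbP _.
  have e1 : 2 * (\sum_x \sum_w Pn x w * (~~ good_pair eta x w)%:R) <= delta / 2.
    have := n1P n n1n; rewrite ler_pdivlMr ?mulr_gt0// => le.
    by have := kappaP n; rewrite -/C /Pn; lra.
  have e2 : expR (- (alpha * N%:R / 2)) <= delta / 2.
    apply: le_trans (n2P n n2n); rewrite ler_expR lerN2; lra.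
  lra.
pose m0 : 'I_N := Ordinal N_gt0.
(* The default message is sent when no codeword is good; its loss is bounded by [L] only. *)
pose enc x := odflt m0 [pick m | good_pair eta x (cb m)].
exists enc, cb => k.
have mu0 : 0 <= mu k.
  by rewrite sumr_ge0// => ? _; rewrite sumr_ge0// => ? _; rewrite mulr_ge0.
rewrite exchange_big mulr_sumr /=.
apply: (@le_trans _ _ (\sum_x pxn x * (mu k + eta + L * [forall m, ~~ good_pair eta x (cb m)]%:R))).
  apply: ler_sum => x _; rewrite -mulr_sumr mulrCA ler_wpM2l ?prodr_ge0//.
  rewrite ler_pdivrMl// /enc; case: pickP => [m good_m|no_good] /=.
    have /andP[/forallP/(_ k) le _] := good_m; apply: le_trans le _.
    by rewrite ler_wpM2l// lerDl mulr_ge0 ?ler0n// ltW.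
  have -> : [forall m, ~~ good_pair eta x (cb m)] by apply/forallP => m; rewrite no_good.
  apply: (@le_trans _ _ (\sum_(i < n) L)); first exact: ler_sum.
  by rewrite sumr_const card_ord -[L *+ n]mulr_natl mulr1 ler_wpM2l// lerDr addr_ge0 ?mu0// ltW.
under eq_bigr do rewrite mulrDr [pxn _ * (L * _)]mulrCA.
rewrite big_split /= -mulr_suml pxn1 mul1r -mulr_sumr.
have : L * \sum_x pxn x * [forall m, ~~ good_pair eta x (cb m)]%:R <= L * delta.
  by rewrite ler_wpM2l// ltW.
have -> : L * delta = eps / 2 by rewrite /delta; field; rewrite gt_eqF.
lra.
Qed.

End GoodCodebooks.

(** * The three losses and achievability *)

Section Losses.
Variables (R : realType) (X Y Z A T1 T2 Th1 Th2 : finType).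
Variable S : problem R X Y Z A T1 T2 Th1 Th2.

(* [None] stands for the cost, [Some false] and [Some true] for the distortions
   at decoders 1 and 2. *)
Definition bound (D1 D2 G : R) (k : option bool) : R :=
  match k with None => G | Some false => D1 | Some true => D2 end.

Section Strategy.
Variables (W : finType) (aW : W -> A) (tW : W -> Th1) (gW : W -> Z -> Th2).

Definition loss (k : option bool) (w : W) (x : X) (y : Y) (z : Z) : R :=
  match k with
  | None => cost S (aW w)
  | Some false => d1 S (f1 S x y z) (tW w)
  | Some true => d2 S (f2 S x y z) (gW w z)
  end.

Lemma loss_ge0 k w x y z : 0 <= loss k w x y z.
Proof. by case: k => [[]|]; [exact: d2_ge0|exact: d1_ge0|exact: cost_ge0]. Qed.

Definition mean_loss k := cond_loss S aW (loss k).

Lemma mean_loss_ge0 k x w : 0 <= mean_loss k x w.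
Proof. by apply: cond_loss_ge0 => *; exact: loss_ge0. Qed.

Variables (n N : nat) (c : code X Z A Th1 Th2 n N).

Definition code_loss (k : option bool) : R :=
  match k with
  | None => avg_cost S c
  | Some false => avg_distortion1 S c
  | Some true => avg_distortion2 S c
  end.

Variable wi : 'I_n -> 'I_N -> {ffun 'I_n -> Z} -> W.
Hypothesis wi_act : forall i m z, aW (wi i m z) = act c m i.
Hypothesis wi_dec1 : forall i m z, tW (wi i m z) = dec1 c m i.
Hypothesis wi_dec2 : forall i m z, gW (wi i m z) (z i) = dec2 c m (prefix z i).
Hypothesis wi_causal : forall (i j : 'I_n) m z v, (i <= j)%N ->
  wi i m (upd z j v) = wi i m z.

Lemma code_lossE k : code_loss k = n%:R^-1 * \sum_(i < n) expect (code_dist S c)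
  (fun '(x, y, z) => mean_loss k (x i) (wi i (enc c x) z)).
Proof.
have -> : code_loss k = n%:R^-1 * \sum_(i < n) expect (code_dist S c)
    (fun '(x, y, z) => loss k (wi i (enc c x) z) (x i) (y i) (z i)).
  case: k => [[]|]; congr (_ * _); apply: eq_bigr => i _; apply: eq_bigr => -[[x y] z] _.
  - by rewrite -wi_dec2.
  - by rewrite -(wi_dec1 _ _ z).
  - by rewrite /loss wi_act.
congr (_ * _); apply: eq_bigr => i _.
by rewrite (code_expect_loss S wi_act wi_causal (loss k)).
Qed.

End Strategy.

Lemma has_codeP n r D1 D2 G :
  has_code S n r D1 D2 G <-> exists c : code X Z A Th1 Th2 n (nb_messages n r),
    forall k, code_loss c k <= bound D1 D2 G k.
Proof.
split=> -[c cP]; exists c; first by case: cP => c0 c1 c2 [[]|].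
by split; [exact: (cP None)|exact: (cP (Some false))|exact: (cP (Some true))].
Qed.

Lemma boundD D1 D2 G e k : bound (D1 + e) (D2 + e) (G + e) k = bound D1 D2 G k + e.
Proof. by case: k => [[]|]. Qed.

Section Channel.
Variables (U : finType) (q : X -> fdist R (A * U * Th1)%type) (that2 : U -> Z -> Th2).

Local Notation W := (A * U * Th1)%type.

(** The triple [(a, u, t1)] acts as a strategy: [u] selects the map [that2 u] of the current
    measurement. *)
Definition tag_loss k :=
  mean_loss (@actW A Th1 U) (fun w : W => w.2) (fun w z => that2 w.1.2 z) k.

Lemma feasibleP D1 D2 G : feasible S q that2 D1 D2 G <->
  forall k, \sum_x \sum_w xw_mass S q x w * tag_loss k x w <= bound D1 D2 G k.
Proof.
have E k : \sum_x \sum_w xw_mass S q x w * tag_loss k x w =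
    expect (joint S q that2) (fun w => match k with
      | None => cost S (rvA w)
      | Some false => d1 S (rvT1 S w) (rvTh1 w)
      | Some true => d2 S (rvT2 S w) (rvTh2 w)
      end).
  rewrite -(joint_expect_loss S q that2).
  rewrite !joint_expect; do 4!(apply: eq_bigr => ? _).
  by case: k => [[]|].
split=> [[c0 c1 c2] k|cP]; first by rewrite E; case: k => [[]|].
by split; [have := cP None|have := cP (Some false)|have := cP (Some true)]; rewrite E.
Qed.

Lemma xw_mass_sum1 : \sum_x \sum_w xw_mass S q x w = 1.
Proof. by under eq_bigr do rewrite xw_mass_row; exact: pX_sum1. Qed.

Lemma info_rate_ge0 : 0 <= info_rate S q that2.
Proof.
rewrite info_rateE divr_ge0 ?ln_ge0 ?ler1n//.
exact: info_ge0 (xw_mass_ge0 S q) xw_mass_sum1.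
Qed.

Lemma achievable_gt_info_rate D1 D2 G r :
  feasible S q that2 D1 D2 G -> info_rate S q that2 < r -> achievable S D1 D2 G r.
Proof.
move=> /feasibleP fea; rewrite info_rateE ltr_pdivrMr ?ln_gt0 ?ltr1n// => Ir eps eps0.
have [n0 n0P] := good_codebooks (xw_mass_ge0 S q) xw_mass_sum1
  (mean_loss_ge0 (@actW A Th1 U) (fun w : W => w.2) (fun w z => that2 w.1.2 z)) Ir eps0.
exists n0 => n /n0P[enc [cb cbP]]; apply/has_codeP.
(* Each codeword letter is a triple [(a, u, t1)]. Decoder 2 reads only the last symbol of its
   prefix, the current measurement. *)
pose c : code X Z A Th1 Th2 n (nb_messages n r) := Code enc
  (fun m => [ffun i => actW (cb m i)]) (fun m => [ffun i => (cb m i).2])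
  (fun i m zs => that2 (cb m i).1.2 (zs ord_max)).
exists c => k; rewrite boundD.
rewrite (@code_lossE _ (@actW A Th1 U) (fun w : W => w.2) (fun w z => that2 w.1.2 z) _ _ c
  (fun i m _ => cb m i)) //=.
- apply: (@le_trans _ _ (_ + eps)) (lerD (fea k) (lexx _)); apply: le_trans (cbP k).
  rewrite le_eqVlt; apply/orP; left; apply/eqP; congr (_ * _); apply: eq_bigr => i _.
  rewrite (code_expect_src S c (fun x => tag_loss k (x i) (cb (enc x) i))).
  apply: eq_bigr => x _; congr (_ * _); apply: eq_bigr => j _.
  by rewrite xw_mass_row.
- by move=> i m z; rewrite ffunE.
- by move=> i m z; rewrite ffunE.
move=> i m z; rewrite ffunE; congr (that2 _ (z _)); exact: val_inj.
Qed.

End Channel.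
End Losses.

(** * Converse *)

Section Converse.
Variables (R : realType) (X Y Z A T1 T2 Th1 Th2 : finType).
Variable S : problem R X Y Z A T1 T2 Th1 Th2.

(* The letter available to both decoders at one position: an action, a
   reconstruction for decoder 1, and, as a function of the current measurement,
   the reconstruction of decoder 2. *)
Definition strategy : finType := (A * Th1 * {ffun Z -> Th2})%type.

Definition strategy_loss k := mean_loss S (fun w : strategy => w.1.1)
  (fun w : strategy => w.1.2) (fun (w : strategy) z => w.2 z) k.

(** The last component freezes the past measurements and overwrites the current one by its argument,
    so it does not depend on [z i]. *)
Definition code_strategy n N (c : code X Z A Th1 Th2 n N)
    (i : 'I_n) (m : 'I_N) (z : {ffun 'I_n -> Z}) : strategy :=
  (act c m i, dec1 c m i, [ffun v => dec2 c m (prefix (upd z i v) i)]).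

Lemma code_occupation n r D1 D2 G : (0 < n)%N -> has_code S n r D1 D2 G ->
  exists P : X -> strategy -> R, [/\ forall x w, 0 <= P x w,
    forall x, \sum_w P x w = pX S x,
    forall k, \sum_x \sum_w P x w * strategy_loss k x w <= bound D1 D2 G k &
    forall rr : X -> strategy -> R, (forall x w, 0 < rr x w) ->
      (forall w, \sum_x rr x w <= 1) ->
      \sum_x \sum_w P x w * ln (rr x w / pX S x) <= r * ln 2].
Proof.
move=> n0 /has_codeP[c cP].
have causal (i j : 'I_n) m z v : (i <= j)%N ->
    code_strategy c i m (upd z j v) = code_strategy c i m z.
  (* A change at [j >= i] reaches the prefix only if [j = i], and that entry is overwritten. *)
  move=> ij; congr (_, _, _); apply/ffunP => v'; rewrite !ffunE; congr (dec2 c m _).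
  apply/ffunP => l; rewrite !ffunE; case: eqP => // li.
  case: eqP => // lj; case: li; apply: val_inj => /=; apply/eqP.
  have lj' : l = j :> nat by rewrite -lj.
  by rewrite eqn_leq -ltnS ltn_ord lj' ij.
exists (occupation S c (code_strategy c)); split.
- by move=> x w; exact: occupation_ge0.
- by move=> x; exact: occupation_fst.
- move=> k; rewrite (occupation_expect S c (code_strategy c) (strategy_loss k)).
  apply: le_trans (cP k); rewrite le_eqVlt; apply/orP; left; apply/eqP.
  rewrite (@code_lossE _ _ _ _ _ _ _ _ _ S strategy (fun w => w.1.1) (fun w => w.1.2)
    (fun w z => w.2 z) _ _ c (code_strategy c)) //.
  by move=> i m z /=; rewrite ffunE upd_id.
move=> rr rr0 rr1.
apply: le_trans (@occupation_info_le _ _ _ _ _ _ _ _ _ S strategy _ _ c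
  (code_strategy c) causal rr n0 rr0 rr1) _.
have [x _] := src_ffun_exists S n.
have N0 : (0 < nb_messages n r)%N by apply: leq_trans (ltn_ord (enc c x)).
rewrite ler_pdivrMl ?ltr0n// mulrA -ln_powR ler_ln ?posrE ?ltr0n ?powR_gt0//.
by have /andP[] := truncn_itv (powR_ge0 (2 : R) (n%:R * r)).
Qed.

(* Compactness, applied to the linear constraints alone: the bound on the
   information is the family of its linear tests [rr]. *)
Lemma limit_strategy_law r D1 D2 G :
  (forall eps, 0 < eps -> exists2 r', achievable S D1 D2 G r' & r' <= r + eps) ->
  exists P : X -> strategy -> R, [/\ forall x w, 0 <= P x w,
    forall x, \sum_w P x w = pX S x,
    forall k, \sum_x \sum_w P x w * strategy_loss k x w <= bound D1 D2 G k &
    info P <= r * ln 2].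
Proof.
move=> ach.
(* One slack serves losses and rate, because [ln 2 <= 1] gives [eps_ k * ln 2 <= eps_ k]. *)
pose eps_ k : R := k.+1%:R^-1.
have eps0 k : 0 < eps_ k by rewrite invr_gt0.
have eps_small e : 0 < e -> exists k0, forall k, (k0 <= k)%N -> eps_ k <= e.
  move=> e0; exists (Num.truncn e^-1) => k k0.
  rewrite -[leRHS]invrK lef_pV2 ?posrE ?invr_gt0//.
  by apply/ltW/(lt_le_trans (truncnS_gt _)); rewrite ler_nat.
pose approx k (P : X -> strategy -> R) := [/\ forall x w, 0 <= P x w,
    forall x, \sum_w P x w = pX S x,
    forall l, \sum_x \sum_w P x w * strategy_loss l x w <= bound D1 D2 G l + eps_ k &
    forall rr : X -> strategy -> R, (forall x w, 0 < rr x w) ->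
      (forall w, \sum_x rr x w <= 1) ->
      \sum_x \sum_w P x w * ln (rr x w / pX S x) <= r * ln 2 + eps_ k].
have [k|P_ P_P] := @choice _ _ approx.
  have [r' /(_ _ (eps0 k))[n0 n0P] r'r] := ach _ (eps0 k).
  have [P [Pge0 Prow Ploss Ptest]] := code_occupation (ltn0Sn n0) (n0P _ (leqnSn n0)).
  exists P; split => // [l|rr rr0 rr1]; first by rewrite -boundD.
  apply: le_trans (Ptest _ rr0 rr1) _.
  have ln2 : 0 < ln 2 :> R by rewrite ln_gt0 ?ltr1n.
  have ln2' : ln 2 <= 1 :> R by have := @ln_le_sub1 R 2; rewrite ltr0n => /(_ isT); lra.
  have : r' * ln 2 <= (r + eps_ k) * ln 2 by rewrite ler_pM2r.
  have : eps_ k * ln 2 <= eps_ k by rewrite ler_piMr// ltW.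
  by lra.
have [|Q QP] := @limit_linear_ineq R (X * strategy)%type (fun k p => P_ k p.1 p.2).
  move=> k [x w] /=; have [P0 Prow _ _] := P_P k; rewrite P0 /=.
  apply: (@le_trans _ _ (pX S x)); first by rewrite -(Prow x) (bigD1 w) //= lerDl sumr_ge0.
  by rewrite -(pX_sum1 S) (bigD1 x) //= lerDl sumr_ge0// => ? _; exact: pX_ge0.
pose P x w := Q (x, w).
have lim (a : X -> strategy -> R) b :
    (forall k, \sum_x \sum_w P_ k x w * a x w <= b + eps_ k) ->
    \sum_x \sum_w P x w * a x w <= b.
  move=> ab.
  have -> : \sum_x \sum_w P x w * a x w = \sum_p a p.1 p.2 * Q p.
    by rewrite pair_bigA; apply: eq_bigr => -[x w] _; rewrite mulrC.
  apply: QP => e /eps_small[k0 k0P]; exists k0 => k /k0P le.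
  rewrite (le_trans _ (lerD (lexx b) le))// (le_trans _ (ab k))//.
  by rewrite pair_bigA le_eqVlt; apply/orP; left; apply/eqP/eq_bigr => p _; rewrite mulrC.
(* Entries and row sums are linear functionals; bounding them and their opposites carries positivity
   and the [X]-marginal to the limit. *)
have pick_sum (F : X -> strategy -> R) x w :
    \sum_x' \sum_w' F x' w' * ((x', w') == (x, w))%:R = F x w.
  rewrite pair_bigA (bigD1 (x, w)) //= eqxx mulr1 big1 ?addr0//.
  by move=> [x' w'] /= /negbTE ->; rewrite mulr0.
have row_sum (F : X -> strategy -> R) x :
    \sum_x' \sum_w' F x' w' * (x' == x)%:R = \sum_w F x w.
  rewrite (bigD1 x) //= eqxx [X in _ + X]big1 ?addr0.
    by apply: eq_bigr => w _; rewrite mulr1.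
  by move=> x' /negbTE ->; rewrite big1// => w _; rewrite mulr0.
have sumN (F a : X -> strategy -> R) :
    \sum_x \sum_w F x w * - a x w = - \sum_x \sum_w F x w * a x w.
  rewrite -sumrN; apply: eq_bigr => x _; rewrite -sumrN.
  by apply: eq_bigr => w _; rewrite mulrN.
have P0 x w : 0 <= P x w.
  rewrite -oppr_le0 -(pick_sum P) -(sumN P (fun x' w' => ((x', w') == (x, w))%:R)).
  apply: lim => k; rewrite sumN pick_sum add0r.
  by have [Pk0 _ _ _] := P_P k; rewrite (@le_trans _ _ 0) ?oppr_le0// ltW.
have Prow x : \sum_w P x w = pX S x.
  apply/eqP; rewrite eq_le; apply/andP; split.
    rewrite -(row_sum P); apply: lim => k; rewrite row_sum.
    by have [_ -> _ _] := P_P k; rewrite lerDl ltW.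
  rewrite -lerN2 -(row_sum P) -(sumN P (fun x' w' => (x' == x)%:R)).
  apply: lim => k; rewrite sumN row_sum.
  by have [_ -> _ _] := P_P k; rewrite lerDl ltW.
exists P; split => // [k|].
  by apply: lim => j; have [_ _ + _] := P_P j; apply.
apply: info_le_tests => //; first by under eq_bigr do rewrite Prow; exact: pX_sum1.
move=> rr rr0 rr1; under eq_bigr do under eq_bigr do rewrite Prow.
by apply: (lim (fun x w => ln (rr x w / pX S x))) => j; have [_ _ _] := P_P j; apply.
Qed.

End Converse.

(** * From few strategies to an auxiliary variable *)

Section Realization.
Variables (R : realType) (X Y Z A T1 T2 Th1 Th2 : finType).
Variable S : problem R X Y Z A T1 T2 Th1 Th2.

Local Notation W := (strategy Z A Th1 Th2).

(** Reweighting strategies keeps the backward channels, so marginals, losses and information are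
    linear in the weights. The constraints are the [#|X|] source masses, which fix the total, and
    three losses. *)
Lemma reduce_strategies (P : X -> W -> R) :
  (forall x w, 0 <= P x w) -> (forall x, \sum_w P x w = pX S x) ->
  exists P' : X -> W -> R, [/\ forall x w, 0 <= P' x w,
    forall x, \sum_w P' x w = pX S x,
    forall k, \sum_x \sum_w P' x w * strategy_loss S k x w =
              \sum_x \sum_w P x w * strategy_loss S k x w,
    info P' <= info P &
    exists2 B : {set W}, (#|B| <= #|X| + 3)%N &
      forall x w, w \notin B -> P' x w = 0].
Proof.
move=> P0 Prow.
pose rho w := \sum_x P x w.
have rho0 w : 0 <= rho w by rewrite sumr_ge0.
have P_rho0 x w : rho w = 0 -> P x w = 0.
  by move=> r0; apply/eqP; apply: contraTT isT => /(col_gt0 P0); rewrite -/(rho w) r0 ltxx.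
pose v (w : W) (j : X + option bool) := match j with
  | inl x => P x w
  | inr k => \sum_x P x w * strategy_loss S k x w
  end.
(* The logarithm is the one of the backward channel against [pX]; new weights cancel in it. *)
pose g w := \sum_x P x w * ln (P x w / (pX S x * rho w)).
(* Weight 1 reproduces [P]; strategies of mass 0 get weight 0, as [support_reduction] asks for
   positive [rho] on the support. *)
pose theta (w : W) : R := (rho w != 0)%:R.
have thetaP x w : theta w * P x w = P x w.
  by rewrite /theta; case: eqVneq => [/(P_rho0 x) ->|_]; rewrite ?mulr0 ?mul1r.
have [|||theta' [theta'0 theta'v theta'g theta'card]] :=
    @support_reduction R W (X + option bool)%type v g rho _ theta.
- move=> u uv; rewrite /rho.
  under eq_bigr do rewrite mulr_sumr.
  by rewrite exchange_big big1// => x _; exact: (uv (inl x)).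
- by move=> w; rewrite /theta.
- by move=> w; rewrite /theta lt0r rho0 andbT; apply: contraNneq => ->; rewrite eqxx.
have row x : \sum_w theta' w * P x w = pX S x.
  by rewrite (theta'v (inl x)) -(Prow x); apply: eq_bigr => w _; rewrite thetaP.
exists (fun x w => theta' w * P x w); split.
- by move=> x w; rewrite mulr_ge0.
- exact: row.
- move=> k; rewrite exchange_big /= [RHS]exchange_big /=.
  have := theta'v (inr k); rewrite /= => e.
  transitivity (\sum_w theta' w * \sum_x P x w * strategy_loss S k x w).
    by apply: eq_bigr => w _; rewrite mulr_sumr; apply: eq_bigr => x _; rewrite mulrA.
  rewrite e; apply: eq_bigr => w _; rewrite mulr_sumr; apply: eq_bigr => x _.
  by rewrite mulrA thetaP.
- have -> : info (fun x w => theta' w * P x w) = \sum_w theta' w * g w.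
    rewrite /info exchange_big /=; apply: eq_bigr => w _.
    rewrite mulr_sumr; apply: eq_bigr => x _.
    rewrite row -mulr_sumr -/(rho w) [RHS]mulrA.
    have [->|t0] := eqVneq (theta' w) 0; first by rewrite !mul0r.
    by rewrite [pX S x * _]mulrCA -mulf_div divff// mul1r.
  have -> : info P = \sum_w theta w * g w.
    rewrite /info exchange_big /=; apply: eq_bigr => w _.
    rewrite mulr_sumr; apply: eq_bigr => x _.
    by rewrite Prow -/(rho w) mulrA thetaP.
  exact: theta'g.
exists [set w | theta' w != 0].
  by move: theta'card; rewrite card_sum card_option card_bool.
by move=> x w; rewrite inE negbK => /eqP ->; rewrite mul0r.
Qed.

(** The auxiliary letter is the strategy itself. It determines the action and the first
    reconstruction, so adding these to it leaves the information unchanged. *)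
Lemma joint_realization (P : X -> W -> R) (B : {set W}) :
  (forall x w, 0 <= P x w) -> (forall x, \sum_w P x w = pX S x) ->
  (forall x w, w \notin B -> P x w = 0) ->
  exists (q : X -> fdist R (A * {w | w \in B} * Th1)%type)
         (that2 : {w | w \in B} -> Z -> Th2),
    (forall k, \sum_x \sum_w xw_mass S q x w * tag_loss S that2 k x w =
               \sum_x \sum_w P x w * strategy_loss S k x w) /\
    info (xw_mass S q) = info P.
Proof.
move=> P0 Prow PB; pose U : finType := {w | w \in B}.
pose io (u : U) : A * U * Th1 := ((val u).1.1, u, (val u).1.2).
have [u0 _] : exists u : U, true.
  have [x _] : exists x : X, true.
    by have [x _] := src_ffun_exists S 1; exists (x ord0).
  have [x' px'] : exists x', pX S x' != 0.
    apply/existsP; apply: contraT; rewrite negb_exists => /forallP p0.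
    have /eqP := pX_sum1 S; rewrite big1 ?(eq_sym 0) ?oner_eq0// => y _.
    by have := p0 y; rewrite negbK => /eqP.
  have [w wB|Bempty] := pickP (mem B); first by exists (exist _ w wB).
  by move: px'; rewrite -Prow big1 ?eqxx// => w _; rewrite PB//; have /= := Bempty w => ->.
(* The conditional law of the strategy given [x], set to a point mass at [u0] when [x] is null. *)
pose f x (u : U) : R := if pX S x == 0 then (u == u0)%:R else P x (val u) / pX S x.
have f0 x u : 0 <= f x u by rewrite /f; case: ifP => // _; rewrite divr_ge0 ?pX_ge0.
have sumB (F : W -> R) : (forall w, w \notin B -> F w = 0) ->
    \sum_(u : U) F (val u) = \sum_w F w.
  move=> FB; rewrite [RHS](bigID (mem B)) /= [X in _ + X]big1 ?addr0//.
  exact/esym/(big_sub B F).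
have f1 x : \sum_u f x u = 1.
  rewrite /f; case: eqVneq => [_|p0].
    by rewrite (bigD1 u0) //= eqxx big1 ?addr0// => u /negbTE ->.
  rewrite -mulr_suml (sumB (P x)) ?Prow ?divff// => w; exact: PB.
pose m x (w : A * U * Th1) : R := f x w.1.2 * (w == io w.1.2)%:R.
have sum_io (F : A * U * Th1 -> R) :
    \sum_w F w * (w == io w.1.2)%:R = \sum_u F (io u).
  rewrite (partition_big (fun w : A * U * Th1 => w.1.2) predT) //=.
  apply: eq_bigr => u _; rewrite (bigD1 (io u)) //= eqxx mulr1 big1 ?addr0//.
  by move=> w /andP[/eqP <- /negbTE ->]; rewrite mulr0.
have m0 x w : 0 <= m x w by rewrite mulr_ge0.
have m1 x : \sum_w m x w = 1 by rewrite (sum_io (fun w => f x w.1.2)) /= f1.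
pose q x := FDist (m0 x) (m1 x).
have massE x w : xw_mass S q x w = P x (val w.1.2) * (w == io w.1.2)%:R.
  rewrite /xw_mass /= /m mulrA /f; congr (_ * _).
  case: eqVneq => [p0|p0]; last by rewrite mulrC divfK.
  rewrite p0 mul0r; apply/esym/eqP.
  have := Prow x; rewrite p0 => /eqP; rewrite psumr_eq0// => /allP.
  by apply; rewrite mem_index_enum.
have sum_mass (phi : X -> A * U * Th1 -> R) (psi : X -> W -> R) :
    (forall x u, phi x (io u) = psi x (val u)) ->
    \sum_x \sum_w xw_mass S q x w * phi x w = \sum_x \sum_w P x w * psi x w.
  move=> phipsi; apply: eq_bigr => x _.
  under eq_bigr do rewrite massE mulrAC.
  rewrite (sum_io (fun w => P x (val w.1.2) * phi x w)) /=.
  under eq_bigr do rewrite phipsi.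
  by rewrite (sumB (fun w => P x w * psi x w))// => w wB; rewrite PB ?mul0r.
exists q, (fun (u : U) z => (val u).2 z); split=> [k|]; first exact: sum_mass.
rewrite /info (sum_mass _ (fun x w => ln (P x w /
  ((\sum_w' P x w') * (\sum_x' P x' w)))))// => x u.
rewrite xw_mass_row Prow massE eqxx mulr1 /=; congr (ln (_ / (_ * _))).
by apply: eq_bigr => x' _; rewrite massE eqxx mulr1.
Qed.

(** The hypothesis admits [r] equal to the infimum of the achievable rates, which is what makes the
    minimum attained. *)
Lemma single_letter_le r D1 D2 G :
  (forall eps, 0 < eps -> exists2 r', achievable S D1 D2 G r' & r' <= r + eps) ->
  exists2 v, single_letter_rates S D1 D2 G v%:E & 0 <= v <= r.
Proof.
move=> /limit_strategy_law[P [P0 Prow Ploss Pinfo]].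
have [P' [P'0 P'row P'loss P'info [B cardB P'B]]] := reduce_strategies P0 Prow.
have [q [that2 [q_loss q_info]]] := joint_realization P'0 P'row P'B.
exists (info_rate S q that2); last first.
  rewrite info_rate_ge0 info_rateE q_info ler_pdivrMr ?ln_gt0 ?ltr1n//.
  exact: le_trans P'info Pinfo.
exists {w | w \in B}, q, that2; split => //.
  (* [#|X| + 3] is within the stated bound since [A] is nonempty: [q] puts mass 1 on triples
     containing an action. *)
  rewrite card_sig (eq_card (B := B)) => [|w]; last by rewrite inE.
  apply: leq_trans cardB _; rewrite leq_add2r leq_pmulr//.
  have [x _] := src_ffun_exists S 1.
  have [[[a u] t1] _|no] := pickP (fun _ : A * {w | w \in B} * Th1 => true).
    by apply/card_gt0P; exists a.
  have /eqP := fdist_sum1 (q (x ord0)); rewrite big1 ?(eq_sym 0) ?oner_eq0// => w.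
  by have := no w.
by apply/feasibleP => k; rewrite q_loss P'loss.
Qed.

End Realization.

Theorem proposition2 (R : realType) (X Y Z A T1 T2 Th1 Th2 : finType)
    (S : problem R X Y Z A T1 T2 Th1 Th2) (D1 D2 G : R)
    (hD1 : 0 <= D1) (hD2 : 0 <= D2) (hG : 0 <= G) :
  is_min (single_letter_rates S D1 D2 G) (rate_function S D1 D2 G).
Proof.
have rate_le v : single_letter_rates S D1 D2 G v -> (rate_function S D1 D2 G <= v)%E.
  move=> [U [q [that2 [_ fea ->]]]]; apply/lee_addgt0Pr => e e0.
  apply: ereal_inf_lbound; exists (info_rate S q that2 + e) => //=.
  by apply: (achievable_gt_info_rate fea); rewrite ltrDl.
have le_achievable r : achievable S D1 D2 G r ->
    exists2 v, single_letter_rates S D1 D2 G v%:E & 0 <= v <= r.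
  by move=> ach; apply: single_letter_le => e e0; exists r => //; rewrite lerDl ltW.
split.
  apply/eqP; rewrite eq_le; apply/andP; split.
    exact: le_ereal_inf_tmp.
  apply: le_ereal_inf_tmp => _ [r /le_achievable[v Vv /andP[_ vr]] <-].
  by apply: le_trans (ereal_inf_lbound Vv) _; rewrite lee_fin.
move=> [v Vv].
(* With a feasible choice at hand the infimum is finite, so [single_letter_le] applies to its real
   value. *)
have rate_ge0 : (0 <= rate_function S D1 D2 G)%E.
  apply: le_ereal_inf_tmp => _ [r /le_achievable[v' _ /andP[v'0 v'r]] <-].
  by rewrite lee_fin (le_trans v'0).
have rate_fin : rate_function S D1 D2 G \is a fin_num.
  rewrite ge0_fin_numE//; apply: le_lt_trans (rate_le _ Vv) _.
  by case: Vv => [U [q [that2 [_ _ ->]]]]; rewrite ltry.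
have [|v' Vv' /andP[_ v'r]] := @single_letter_le _ _ _ _ _ _ _ _ _ S
  (fine (rate_function S D1 D2 G)) D1 D2 G.
  move=> e e0.
  have [_ [r ach <-]] := @lb_ereal_inf_adherent R _ e e0 rate_fin.
  rewrite -/(rate_function S D1 D2 G) -(fineK rate_fin) -EFinD lte_fin => /ltW re.
  by exists r.
suff -> : rate_function S D1 D2 G = v'%:E by [].
apply/eqP; rewrite eq_le rate_le//= -(fineK rate_fin) lee_fin.
exact: v'r.
Qed.
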